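(* There exists a non-separable AF-algebra which is prime but not primitive.
   Context: A $C^*$-algebra (not necessarily separable) is called an AF-algebra if it has a family of finite dimensional $C^*$-subalgebras, directed under inclusion, whose union is dense. A $C^*$-algebra is prime if any two non-zero closed two-sided ideals have non-zero intersection, and primitive if it has a faithful irreducible $*$-representation on a Hilbert space. *)

(* Defs.v *)
From HB Require Import structures.
From mathcomp Require Import all_boot all_order all_algebra.
From mathcomp Require Import sesquilinear complex.
From mathcomp Require Import all_classical all_reals topology normedtype.

Set Implicit Arguments.
Unset Strict Implicit.
Unset Printing Implicit Defensive.

Import Order.TTheory GRing.Theory Num.Theory.
Import numFieldNormedType.Exports.

Local Open Scope classical_set_scope.
Local Open Scope ring_scope.

(* Not assumed unital, so the product is not the one of MathComp's rings, which
   all have a unit.  The scalars are R[i], i.e. the complex numbers, and the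
   norm `|x| of a normed module over R[i] is R[i]-valued (with values in the
   nonnegative reals). *)
HB.mixin Record CompleteNormedModule_isCStarAlgebra (R : realType) (A : Type)
    of CompleteNormedModule R[i] A := {
  cmul : A -> A -> A;
  star : A -> A;
  cmulA : associative cmul;
  cmulDl : left_distributive cmul +%R;
  cmulDr : right_distributive cmul +%R;
  cscaleAl : forall (k : R[i]) (a b : A), k *: cmul a b = cmul (k *: a) b;
  cscaleAr : forall (k : R[i]) (a b : A), k *: cmul a b = cmul a (k *: b);
  starK : involutive star;
  starD : {morph star : a b / a + b};
  starZ : forall (k : R[i]) (a : A), star (k *: a) = Num.conj k *: star a;
  starM : forall a b : A, star (cmul a b) = cmul (star b) (star a);
  cmul_norm_le : forall a b : A, `|cmul a b| <= `|a| * `|b|;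
  cstar_identity : forall a : A, `|cmul (star a) a| = `|a| ^+ 2
}.

#[short(type="cstarAlgebraType")]
HB.structure Definition CStarAlgebra (R : realType) :=
  {A of CompleteNormedModule R[i] A & CompleteNormedModule_isCStarAlgebra R A}.

(* The inner product is linear in its first argument.  The carrier is a
   completeNormedModType, to which every C*-algebra coerces: hence the carriers
   of Hilbert spaces live in a universe at least as large as those of
   C*-algebras, and quantifying over Hilbert spaces is not limited by size. *)
Record hilbertSpace (R : realType) := HilbertSpace {
  hilbert_carrier :> completeNormedModType R[i];
  inner : {dot hilbert_carrier for (@Num.conj R[i])};
  inner_norm : forall x : hilbert_carrier, inner x x = `|x| ^+ 2
}.
Arguments inner {R h}.

Definition separable_space (T : topologicalType) : Prop :=
  exists D : set T, countable D /\ dense D.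

Section CStarAlgebraNotions.
Context (R : realType) (A : cstarAlgebraType R).

Definition cstar_subalgebra (B : set A) : Prop :=
  [/\ closed B, submod_closed (mem B),
      forall a b, B a -> B b -> B (cmul a b) &
      forall a, B a -> B (star a)].

Definition finite_dimensional (B : set A) : Prop :=
  exists (n : nat) (e : 'I_n -> A),
    B = range (fun c : 'I_n -> R[i] => \sum_i c i *: e i).

Definition AF_algebra : Prop :=
  exists F : set (set A),
    [/\ forall B, F B -> cstar_subalgebra B /\ finite_dimensional B,
        forall B C, F B -> F C -> exists D, [/\ F D, B `<=` D & C `<=` D] &
        dense (\bigcup_(B in F) B)].

Definition closed_ideal (I : set A) : Prop :=
  [/\ closed I, submod_closed (mem I),
      forall a x, I x -> I (cmul a x) &
      forall a x, I x -> I (cmul x a)].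

Definition prime_algebra : Prop :=
  forall I J : set A, closed_ideal I -> closed_ideal J ->
    I <> [set 0] -> J <> [set 0] -> I `&` J <> [set 0].

Definition star_representation (H : hilbertSpace R) (pi : A -> H -> H) : Prop :=
  [/\ forall a, linear (pi a) /\ continuous (pi a),
      forall (k : R[i]) a b x, pi (k *: a + b) x = k *: pi a x + pi b x,
      forall a b x, pi (cmul a b) x = pi a (pi b x) &
      forall a x y, inner (pi a x) y = inner x (pi (star a) y)].

(* The first conjunct excludes the zero representation, on the zero space or on
   a one-dimensional one. *)
Definition irreducible_representation (H : hilbertSpace R)
    (pi : A -> H -> H) : Prop :=
  (exists a x, pi a x <> 0) /\
  forall V : set H, closed V -> submod_closed (mem V) ->
    (forall a x, V x -> V (pi a x)) -> V = [set 0] \/ V = [set: H].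

Definition primitive_algebra : Prop :=
  exists (H : hilbertSpace R) (pi : A -> H -> H),
    [/\ star_representation pi, irreducible_representation pi & injective pi].

End CStarAlgebraNotions.

(* Main.v *)
(* Fix an uncountable set X of letters and let W be the set of finite words over
   X.  For words p, q that are permutations of each other, let E p q be the
   partial isometry of l^2(W) sending the basis vector of q ++ z to that of
   p ++ z, for every z, and vanishing on the other basis vectors; A is the
   C*-algebra generated by these matrix units.  All of them preserve the finite
   dimensional blocks spanned by the permutations of one word, so elements of A
   are families of finite matrices and no operator theory is needed.
   - Matrix units over finitely many words, closed under permutation, span a
     finite dimensional *-algebra: A is AF.
   - An element of A involves only countably many letters.  If a has the entry
     k <> 0 at (w, u), then for a letter x not involved in a,
     E wx wx * a * E ux ux = k E wx ux.  So every nonzero ideal contains some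
     E p p, and if E p p is in I and E q q in J then E (pq) (qp) is in both.
   - In a representation, the projections E v v for words v of a fixed length
     are orthogonal, so given a vector h <> 0, countably many v have E v v h <> 0
     and some letter x is in none of them.  The vectors killed by all E v v with
     v containing x form a closed invariant subspace containing h, so it is the
     whole space if the representation is irreducible, and then E x x acts as 0. *)
From HB Require Import structures.
Require Import Defs.
From mathcomp Require Import all_boot all_order all_algebra.
From mathcomp Require Import sesquilinear complex.
From mathcomp Require Import all_classical all_reals topology normedtype.
From mathcomp Require Import ring lra.

Set Implicit Arguments.
Unset Strict Implicit.
Unset Printing Implicit Defensive.

Import Order.TTheory GRing.Theory Num.Theory.
Import numFieldNormedType.Exports.
Import ComplexField.Normc.

Local Open Scope classical_set_scope.
Local Open Scope ring_scope.
Local Open Scope complex_scope.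

(** * The real-valued modulus of complex numbers and weighted square inequalities *)

Section ComplexModulus.
Context (R : realType).
Implicit Types z w : R[i].

Lemma normc_ge0 z : 0 <= normc z.
Proof. by case: z => a b; exact: sqrtr_ge0. Qed.

Lemma normr_complexE z : `|z| = (normc z)%:C.
Proof. by case: z. Qed.

Lemma normcJ z : normc (Num.conj z) = normc z.
Proof. by apply: complexI; rewrite -!normr_complexE norm_conjC. Qed.

Lemma normc_sum (I : Type) (s : seq I) (F : I -> R[i]) :
  normc (\sum_(i <- s) F i) <= \sum_(i <- s) normc (F i).
Proof.
elim/big_ind2 : _ => [|x m y n xm yn|//]; first by rewrite normc0.
exact: le_trans (le_normcD _ _) (lerD xm yn).
Qed.

Lemma sqr_normc_conj z : (normc z ^+ 2)%:C = z * Num.conj z.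
Proof. by rewrite -normCK normr_complexE rmorphXn. Qed.

(** Young's inequality: the weight [t] stays free, so that a suitable choice of it later yields the
    triangle inequality for square norms without square roots. *)
Lemma sqr_normcD z w (t : R) : 0 < t ->
  normc (z + w) ^+ 2 <= (1 + t) * normc z ^+ 2 + (1 + t^-1) * normc w ^+ 2.
Proof.
move=> t0; have := le_normcD z w; set p := normc z; set q := normc w => h.
have h2 : normc (z + w) ^+ 2 <= (p + q) ^+ 2.
  by rewrite ler_sqr ?nnegrE ?addr_ge0 ?normc_ge0.
apply: (le_trans h2); rewrite -subr_ge0.
have -> : (1 + t) * p ^+ 2 + (1 + t^-1) * q ^+ 2 - (p + q) ^+ 2
   = t^-1 * (t * p - q) ^+ 2 by field; rewrite gt_eqF.
by rewrite mulr_ge0 ?sqr_ge0 // invr_ge0 ltW.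
Qed.

(* AM-GM in place of Cauchy-Schwarz: optimizing over [t] gives the latter. *)
Lemma normc_inner_le (I : Type) (s : seq I) (f g : I -> R[i]) (t : R) : 0 < t ->
  normc (\sum_(i <- s) f i * Num.conj (g i)) <=
  (t * \sum_(i <- s) normc (f i) ^+ 2 + t^-1 * \sum_(i <- s) normc (g i) ^+ 2) / 2.
Proof.
move=> t0; apply: (le_trans (normc_sum _ _)).
rewrite !mulr_sumr -big_split /= mulr_suml; apply: ler_sum => i _.
rewrite normcM normcJ; set p := normc _; set q := normc _.
rewrite -subr_ge0.
have -> : (t * p ^+ 2 + t^-1 * q ^+ 2) / 2 - p * q
   = t^-1 * (t * p - q) ^+ 2 / 2 by field; rewrite gt_eqF.
by rewrite divr_ge0 // mulr_ge0 ?sqr_ge0 // invr_ge0 ltW.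
Qed.

End ComplexModulus.

Lemma ler_sum_sub (R : numDomainType) (T : eqType) (s t : seq T) (F : T -> R) :
  uniq s -> uniq t -> {subset s <= t} -> (forall x, 0 <= F x) ->
  \sum_(x <- s) F x <= \sum_(x <- t) F x.
Proof.
move=> us ut st F0; rewrite [leRHS](bigID (mem s)) /=.
suff -> : \sum_(x <- s) F x = \sum_(x <- t | x \in s) F x.
  by rewrite lerDl sumr_ge0.
rewrite -[RHS]big_filter; apply: perm_big; apply: uniq_perm => //.
  exact: filter_uniq.
by move=> x; rewrite mem_filter; case: (boolP (x \in s)) => // /st ->.
Qed.

(** * Matrices indexed by words, their operations and bounds on their blocks *)

Section BlockMatrices.
Context (R : realType) (X : choiceType).
Local Notation C := R[i].
Local Notation word := (seq X).

Definition blockmx := word -> word -> C.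
Implicit Types (a b c : blockmx) (f : word -> C) (p q u v w s t : word).

Lemma sum_permutations (V : nmodType) u v (F : word -> V) : perm_eq u v ->
  \sum_(w <- permutations u) F w = \sum_(w <- permutations v) F w.
Proof. by move=> uv; apply: perm_big; rewrite perm_permutations. Qed.

Lemma sum_permutations1 (V : nmodType) u v (F : word -> V) : perm_eq v u ->
  (forall w, w != v -> F w = 0) -> \sum_(w <- permutations u) F w = F v.
Proof.
move=> vu F0; rewrite (bigD1_seq v) ?permutations_uniq ?mem_permutations //=.
by rewrite big1 ?addr0.
Qed.

Definition mx_app a f u : C := \sum_(v <- permutations u) a u v * f v.
(** Summing over the rearrangements of the row index keeps the sum finite; this is the full matrix
    product as soon as [a] is supported on the blocks. *)
Definition mx_mul a b : blockmx :=
  fun u v => \sum_(w <- permutations u) a u w * b w v.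
Definition mx_star a : blockmx := fun u v => Num.conj (a v u).
(** The entries 1 are those at row [p ++ z] and column [q ++ z]; [drop (size p) s] recovers [z] from
    the row. *)
Definition mx_unit p q : blockmx :=
  fun s t => (prefix p s && (t == q ++ drop (size p) s))%:R.
Definition vsqnorm u f : R := \sum_(w <- permutations u) normc (f w) ^+ 2.

Definition block_supp a := forall u v, ~~ perm_eq u v -> a u v = 0.
(** Every block has operator norm at most |M|. Only the square of [M] occurs, hence the separate
    sign conditions on [M] in the lemmas below. *)
Definition mx_bound (M : R) a := block_supp a /\
  forall u f, vsqnorm u (mx_app a f) <= M ^+ 2 * vsqnorm u f.

Lemma vsqnorm_ge0 u f : 0 <= vsqnorm u f.
Proof. by apply: sumr_ge0 => w _; exact: sqr_ge0. Qed.
Hint Resolve vsqnorm_ge0 : core.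

Lemma eq_vsqnorm u f g : (forall v, perm_eq v u -> f v = g v) ->
  vsqnorm u f = vsqnorm u g.
Proof.
by move=> fg; apply: eq_big_seq => w; rewrite mem_permutations => /fg ->.
Qed.

Lemma mx_appM a b f u : mx_app (mx_mul a b) f u = mx_app a (mx_app b f) u.
Proof.
rewrite /mx_app /mx_mul; under eq_bigr do rewrite mulr_suml.
rewrite exchange_big /=; apply: eq_big_seq => w; rewrite mem_permutations => wu.
rewrite -(sum_permutations _ wu) mulr_sumr; apply: eq_bigr => v _.
by rewrite mulrA.
Qed.

Lemma mx_mulA a b c : mx_mul a (mx_mul b c) = mx_mul (mx_mul a b) c.
Proof.
by apply/funext => u; apply/funext => v; rewrite [RHS](mx_appM a b (c^~ v)).
Qed.

Lemma mx_addE a b u v : (a + b) u v = a u v + b u v.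
Proof. by []. Qed.

Lemma mx_scaleE (k : C) a u v : (k *: a) u v = k * a u v.
Proof. by []. Qed.

Lemma mx_mulDl a b c : mx_mul (a + b) c = mx_mul a c + mx_mul b c.
Proof.
apply/funext => u; apply/funext => v.
rewrite mx_addE /mx_mul -big_split /=.
by apply: eq_bigr => w _; rewrite mx_addE mulrDl.
Qed.

Lemma mx_mulDr a b c : mx_mul a (b + c) = mx_mul a b + mx_mul a c.
Proof.
apply/funext => u; apply/funext => v.
rewrite mx_addE /mx_mul -big_split /=.
by apply: eq_bigr => w _; rewrite mx_addE mulrDr.
Qed.

Lemma mx_scaleAl (k : C) a b : k *: mx_mul a b = mx_mul (k *: a) b.
Proof.
apply/funext => u; apply/funext => v; rewrite mx_scaleE mulr_sumr.
by apply: eq_bigr => w _; rewrite mulrA.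
Qed.

Lemma mx_scaleAr (k : C) a b : k *: mx_mul a b = mx_mul a (k *: b).
Proof.
apply/funext => u; apply/funext => v; rewrite mx_scaleE mulr_sumr.
by apply: eq_bigr => w _; rewrite mulrCA.
Qed.

Lemma mx_starK : involutive mx_star.
Proof. by move=> a; apply/funext => u; apply/funext => v; exact: conjCK. Qed.

Lemma mx_starD a b : mx_star (a + b) = mx_star a + mx_star b.
Proof. by apply/funext => u; apply/funext => v; exact: rmorphD. Qed.

Lemma mx_starZ (k : C) a : mx_star (k *: a) = Num.conj k *: mx_star a.
Proof. by apply/funext => u; apply/funext => v; exact: rmorphM. Qed.

(** The two products sum over the rearrangements of different indices. These agree inside a block,
    and block support makes both sides vanish outside. *)
Lemma mx_starM a b : block_supp a -> block_supp b ->
  mx_star (mx_mul a b) = mx_mul (mx_star b) (mx_star a).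
Proof.
move=> sa sb; apply/funext => u; apply/funext => v.
rewrite /mx_star /mx_mul rmorph_sum /=.
have [uv|uv] := boolP (perm_eq u v).
  rewrite (sum_permutations _ uv); apply: eq_bigr => w _.
  by rewrite rmorphM mulrC.
rewrite big_seq big1 ?conjC0 => [|w]; last first.
  rewrite mem_permutations => wv; have -> : b w u = 0 by apply: sb; rewrite (permPl wv) perm_sym.
  by rewrite mulr0 conjC0.
rewrite big_seq big1 // => w; rewrite mem_permutations => wu.
have -> : a v w = 0 by apply: sa; rewrite perm_sym (permPl wu).
by rewrite conjC0 mulr0.
Qed.

Lemma mx_app_adjoint u a f g :
  \sum_(w <- permutations u) mx_app a f w * Num.conj (g w) =
  \sum_(w <- permutations u) f w * Num.conj (mx_app (mx_star a) g w).
Proof.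
rewrite big_seq; under eq_bigr => w wu.
  rewrite mem_permutations in wu.
  rewrite /mx_app (sum_permutations _ wu) mulr_suml; over.
rewrite -big_seq exchange_big /= [RHS]big_seq.
under [RHS]eq_bigr => w wu.
  rewrite mem_permutations in wu.
  rewrite /mx_app (sum_permutations _ wu) rmorph_sum mulr_sumr; over.
rewrite -[RHS]big_seq; apply: eq_bigr => w _; apply: eq_bigr => v _.
by rewrite /mx_star rmorphM /= conjCK mulrAC mulrC mulrA.
Qed.

Lemma vsqnorm_inner u f :
  (vsqnorm u f)%:C = \sum_(w <- permutations u) f w * Num.conj (f w).
Proof.
by rewrite /vsqnorm rmorph_sum /=; apply: eq_bigr => w _; rewrite -sqr_normc_conj.
Qed.

(* The left side is the inner product of [a^* a f] and [f]. *)
Lemma vsqnorm_app_le u a f (t : R) : 0 < t ->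
  vsqnorm u (mx_app a f) <=
  (t * vsqnorm u (mx_app (mx_mul (mx_star a) a) f) + t^-1 * vsqnorm u f) / 2.
Proof.
move=> t0; suff -> : vsqnorm u (mx_app a f) = normc
    (\sum_(w <- permutations u) mx_app (mx_mul (mx_star a) a) f w * Num.conj (f w)).
  exact: normc_inner_le.
have -> : \sum_(w <- permutations u)
    mx_app (mx_mul (mx_star a) a) f w * Num.conj (f w) =
    (vsqnorm u (mx_app a f))%:C.
  rewrite vsqnorm_inner -[in RHS](mx_starK a) -mx_app_adjoint mx_starK.
  by apply: eq_bigr => w _; rewrite mx_appM.
by apply: complexI; rewrite -normr_complexE ger0_norm // ler0c.
Qed.

Lemma mx_boundW (M M' : R) a : 0 <= M -> M <= M' -> mx_bound M a -> mx_bound M' a.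
Proof.
move=> M0 MM' [sa ba]; split => // u f; apply: (le_trans (ba u f)).
apply: ler_wpM2r => //; rewrite ler_sqr // nnegrE //.
exact: le_trans M0 MM'.
Qed.

Lemma mx_bound0 (M : R) : mx_bound M 0.
Proof.
split => // u f; rewrite [leLHS]big1 => [|w _]; first exact: mulr_ge0 (sqr_ge0 _) _.
by rewrite /mx_app big1 ?normc0 ?expr0n // => v _; rewrite mul0r.
Qed.

Lemma mx_boundD (M M' : R) a b : 0 < M -> 0 < M' -> mx_bound M a -> mx_bound M' b ->
  mx_bound (M + M') (a + b).
Proof.
move=> M0 M'0 [sa ba] [sb bb]; split=> [u v uv|u f].
  by rewrite mx_addE sa // sb // addr0.
(* With the weight M' / M the two terms of [sqr_normcD] add up to exactly (M + M')^2 times the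
   square norm of [f]. *)
have t0 : 0 < M' / M by rewrite divr_gt0.
have -> : (M + M') ^+ 2 * vsqnorm u f =
    (1 + M' / M) * (M ^+ 2 * vsqnorm u f) +
    (1 + (M' / M)^-1) * (M' ^+ 2 * vsqnorm u f).
  by field; rewrite !gt_eqF.
apply: (@le_trans _ _ ((1 + M' / M) * vsqnorm u (mx_app a f) +
    (1 + (M' / M)^-1) * vsqnorm u (mx_app b f))).
  rewrite /vsqnorm !mulr_sumr -big_split; apply: ler_sum => w _ /=.
  suff -> : mx_app (a + b) f w = mx_app a f w + mx_app b f w by exact: sqr_normcD.
  by rewrite /mx_app -big_split; apply: eq_bigr => v _; rewrite mx_addE mulrDl.
by apply: lerD; apply: ler_wpM2l => //; rewrite addr_ge0 ?invr_ge0 // ltW.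
Qed.

Lemma mx_boundZ (M : R) (k : C) a : mx_bound M a -> mx_bound (normc k * M) (k *: a).
Proof.
move=> [sa ba]; split=> [u v uv|u f].
  by rewrite mx_scaleE sa // mulr0.
have -> : vsqnorm u (mx_app (k *: a) f) = normc k ^+ 2 * vsqnorm u (mx_app a f).
  rewrite /vsqnorm mulr_sumr; apply: eq_bigr => w _.
  rewrite -exprMn -normcM; congr (normc _ ^+ 2).
  by rewrite /mx_app mulr_sumr; apply: eq_bigr => v _; rewrite mulrA.
by rewrite exprMn -[leRHS]mulrA; apply: ler_wpM2l; [exact: sqr_ge0|exact: ba].
Qed.

Lemma block_suppM a b : block_supp a -> block_supp b -> block_supp (mx_mul a b).
Proof.
move=> sa sb u v uv; rewrite /mx_mul big_seq big1 // => w.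
by rewrite mem_permutations => wu; rewrite sb ?mulr0 // (permPl wu).
Qed.

Lemma block_supp_star a : block_supp a -> block_supp (mx_star a).
Proof. by move=> sa u v uv; rewrite /mx_star sa ?conjC0 // perm_sym. Qed.

Lemma mx_boundM (M M' : R) a b : mx_bound M a -> mx_bound M' b ->
  mx_bound (M * M') (mx_mul a b).
Proof.
move=> [sa ba] [sb bb]; split=> [|u f]; first exact: block_suppM.
rewrite (@eq_vsqnorm u _ (mx_app a (mx_app b f))); last first.
  by move=> v _; exact: mx_appM.
apply: (le_trans (ba _ _)); rewrite exprMn -[leRHS]mulrA.
by apply: ler_wpM2l; [exact: sqr_ge0|exact: bb].
Qed.

(** Let n and m be the square norms of [mx_star a] applied to [f] and of [f]. Taking t = M^-2 in
    [vsqnorm_app_le] and bounding [a] by [M] gives n <= (n + M^2 m) / 2, and n is absorbed on the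
    left. *)
Lemma mx_bound_star (M : R) a : 0 < M -> mx_bound M a -> mx_bound M (mx_star a).
Proof.
move=> M0 [sa ba]; split=> [|u f]; first exact: block_supp_star.
have tp : 0 < (M ^+ 2)^-1 by rewrite invr_gt0 exprn_gt0.
have := vsqnorm_app_le u (mx_star a) f tp; rewrite mx_starK.
rewrite (@eq_vsqnorm u (mx_app (mx_mul a (mx_star a)) f)
  (mx_app a (mx_app (mx_star a) f))); last first.
  by move=> v _; exact: mx_appM.
set n := vsqnorm u (mx_app (mx_star a) f); set m := vsqnorm u f.
have : (M ^+ 2)^-1 * vsqnorm u (mx_app a (mx_app (mx_star a) f)) <= n.
  by rewrite mulrC ler_pdivrMr ?exprn_gt0 // mulrC; exact: ba.
by rewrite invrK; lra.
Qed.

(** The weight t = K^-1 in [vsqnorm_app_le] turns both terms into K times the square norm of [f]. *)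
Lemma mx_bound_cstar (K M : R) a : 0 < K -> K = M ^+ 2 -> block_supp a ->
  mx_bound K (mx_mul (mx_star a) a) -> mx_bound M a.
Proof.
move=> K0 KM sa [_ ba]; split=> // u f; rewrite -KM.
have tp : 0 < K^-1 by rewrite invr_gt0.
apply: (le_trans (vsqnorm_app_le u a f tp)); rewrite invrK.
have : K^-1 * vsqnorm u (mx_app (mx_mul (mx_star a) a) f) <= K * vsqnorm u f.
  by rewrite mulrC ler_pdivrMr // mulrC mulrA -expr2.
by lra.
Qed.

(** Apply [a] to the basis vector of [v] and keep only the coordinate [u]. *)
Lemma mx_bound_entry (M : R) a u v : 0 <= M -> mx_bound M a -> normc (a u v) <= M.
Proof.
move=> M0 [sa ba]; have [uv|uv] := boolP (perm_eq u v); last first.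
  by rewrite sa // normc0.
pose f w : C := (w == v)%:R.
have fv : f v = 1 by rewrite /f eqxx.
have := ba u f.
rewrite {2}/vsqnorm (@sum_permutations1 _ _ v) 1?perm_sym //; last first.
  by move=> w wv; rewrite /f (negPf wv) normc0 expr0n.
rewrite fv normc1 expr1n mulr1 => h.
rewrite -ler_sqr ?nnegrE ?normc_ge0 //; apply: le_trans h.
rewrite /vsqnorm (bigD1_seq u) ?permutations_uniq ?mem_permutations //=.
suff -> : mx_app a f u = a u v by rewrite lerDl sumr_ge0 // => w _; exact: sqr_ge0.
rewrite /mx_app (@sum_permutations1 _ _ v) 1?perm_sym //; last first.
  by move=> w wv; rewrite /f (negPf wv) mulr0.
by rewrite fv mulr1.
Qed.

End BlockMatrices.

(** * Matrix units, the norm closure of their span, and the operator norm *)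

Section MatrixUnits.
Context (R : realType) (X : choiceType).
Local Notation C := R[i].
Local Notation word := (seq X).
Local Notation blockmx := (blockmx R X).
Local Notation E := (@mx_unit R X).
Implicit Types (a b c : blockmx) (p q r z u v w s t : word).

Lemma sum_mx_unit p q s (g : word -> C) : perm_eq p q ->
  \sum_(w <- permutations s) E p q s w * g w =
  if prefix p s then g (q ++ drop (size p) s) else 0.
Proof.
move=> pq; rewrite /mx_unit; case: prefixP => [[z ->]|_]; last first.
  by rewrite big1 // => w _; rewrite mul0r.
rewrite drop_size_cat // (@sum_permutations1 _ _ _ (q ++ z)).
- by rewrite eqxx mul1r.
- by rewrite perm_cat2r perm_sym.
- by move=> w /negPf ->; rewrite mul0r.
Qed.

Lemma mx_unit_mulE p q b s t : perm_eq p q ->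
  mx_mul (E p q) b s t = if prefix p s then b (q ++ drop (size p) s) t else 0.
Proof. by move=> pq; exact: (sum_mx_unit s (b^~ t) pq). Qed.

(** On words that begin with [q ++ z], the unit [E q r] coincides with [E (q ++ z) (r ++ z)]. *)
Lemma mx_unit_mull p q r z : perm_eq p (q ++ z) ->
  mx_mul (E p (q ++ z)) (E q r) = E p (r ++ z).
Proof.
move=> pq; apply/funext => s; apply/funext => t; rewrite mx_unit_mulE // /mx_unit.
case: prefixP => //= -[y ->]; rewrite drop_size_cat // -!catA prefix_prefix.
by rewrite drop_size_cat.
Qed.

Lemma mx_unit_mulr p q r z : perm_eq p q ->
  mx_mul (E p q) (E (q ++ z) r) = E (p ++ z) r.
Proof.
move=> pq; apply/funext => s; apply/funext => t; rewrite mx_unit_mulE // /mx_unit.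
case: (@prefixP _ p s) => [[y ->]|ps].
  have dropE x : drop (size (x ++ z)) (x ++ y) = drop (size z) y.
    by rewrite size_cat addnC -drop_drop drop_size_cat.
  by rewrite (drop_size_cat y (erefl (size p))) !prefix_catr // !eqxx /= !dropE.
case: prefixP => // -[y sE]; case: ps; exists (z ++ y); by rewrite sE catA.
Qed.

(** No word extends both [q] and [r] when neither is a prefix of the other. *)
Lemma mx_unit_mul0 p q r s : perm_eq p q -> ~~ prefix q r -> ~~ prefix r q ->
  mx_mul (E p q) (E r s) = 0.
Proof.
move=> pq qr rq; apply/funext => u; apply/funext => v; rewrite mx_unit_mulE //.
case: ifP => // _; rewrite /mx_unit; set z := drop _ _.
suff -> : prefix r (q ++ z) = false by [].
apply/negP => /prefixP[y].
have [le|/ltnW le] := leqP (size r) (size q) => /(congr1 (take (size r))).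
  rewrite (take_size_cat y (erefl (size r))) takel_cat // => qE.
  by case/negP: rq; apply/prefixP; exists (drop (size r) q); rewrite -{1}qE cat_take_drop.
rewrite (take_size_cat y (erefl (size r))) take_cat ltnNge le /= => rE.
by case/negP: qr; apply/prefixP; exists (take (size r - size q) z).
Qed.

Lemma mx_unit_supp p q : perm_eq p q -> block_supp (E p q).
Proof.
move=> pq s t st; rewrite /mx_unit; case: prefixP => // -[z sE].
case: eqP => // tE; case/negP: st.
by rewrite tE sE drop_size_cat // perm_cat2r.
Qed.

Lemma mx_unit_star p q : mx_star (E p q) = E q p.
Proof.
apply/funext => s; apply/funext => t; rewrite /mx_star /mx_unit conjC_nat.
congr ((nat_of_bool _)%:R); apply/idP/idP => /andP[/prefixP[z ->]]; rewrite drop_size_cat //.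
  by move/eqP=> ->; rewrite prefix_prefix drop_size_cat // eqxx.
by move/eqP=> ->; rewrite prefix_prefix drop_size_cat // eqxx.
Qed.

(** A partial isometry: the nonzero coordinates of the image are coordinates of [f], each taken once
    because [phi] is injective on the words that begin with [p]. *)
Lemma mx_unit_bound p q : perm_eq p q -> mx_bound 1 (E p q).
Proof.
move=> pq; split=> [|u f]; first exact: mx_unit_supp.
rewrite expr1n mul1r /vsqnorm.
pose phi w := q ++ drop (size p) w.
have -> : \sum_(w <- permutations u) normc (mx_app (E p q) f w) ^+ 2 =
    \sum_(v <- map phi (seq.filter (prefix p) (permutations u))) normc (f v) ^+ 2.
  rewrite big_map big_filter [RHS]big_mkcond; apply: eq_bigr => w _.
  by rewrite /mx_app sum_mx_unit //; case: ifP => // _; rewrite normc0 expr0n.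
apply: ler_sum_sub => [|||v]; last exact: sqr_ge0.
- rewrite map_inj_in_uniq ?filter_uniq ?permutations_uniq // => s t.
  rewrite !mem_filter => /andP[/prefixP[y ->] _] /andP[/prefixP[z ->] _].
  by rewrite /phi !drop_size_cat // => /eqP; rewrite eqseq_cat // => /andP[_ /eqP ->].
- exact: permutations_uniq.
- move=> v /mapP[w]; rewrite mem_filter !mem_permutations => /andP[/prefixP[z ->] pu] ->.
  by rewrite /phi drop_size_cat // -(permPr pu) perm_cat2r perm_sym.
Qed.

Inductive mx_span : blockmx -> Prop :=
| mx_span0 : mx_span 0
| mx_spanS (k : C) p q a : perm_eq p q -> mx_span a -> mx_span (k *: E p q + a).

Lemma mx_span_unit p q : perm_eq p q -> mx_span (E p q).
Proof.
by move=> pq; rewrite -[E p q]addr0 -[E p q]scale1r; apply: mx_spanS (mx_span0).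
Qed.

Lemma mx_spanD a b : mx_span a -> mx_span b -> mx_span (a + b).
Proof.
move=> sa sb; elim: sa => [|k p q c pq _ IH]; first by rewrite add0r.
by rewrite -addrA; apply: mx_spanS.
Qed.

Lemma mx_spanZ (k : C) a : mx_span a -> mx_span (k *: a).
Proof.
elim=> [|l p q c pq _ IH]; first by rewrite scaler0; exact: mx_span0.
by rewrite scalerDr scalerA; apply: mx_spanS.
Qed.

Lemma mx_mul0 a : mx_mul a 0 = 0.
Proof.
by apply/funext => u; apply/funext => v; rewrite /mx_mul big1 // => w _; rewrite mulr0.
Qed.

Lemma mx_0mul a : mx_mul 0 a = 0.
Proof.
by apply/funext => u; apply/funext => v; rewrite /mx_mul big1 // => w _; rewrite mul0r.
Qed.

(** This makes the span an algebra: when one of the inner words [q], [r] is a prefix of the other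
    the product is again a matrix unit, and otherwise it is 0. *)
Lemma mx_span_unit_mul p q r s : perm_eq p q -> perm_eq r s ->
  mx_span (mx_mul (E p q) (E r s)).
Proof.
move=> pq rs; have [/prefixP[z rE]|qr] := boolP (prefix q r).
  rewrite rE mx_unit_mulr //; apply: mx_span_unit.
  by rewrite -(permPr rs) rE perm_cat2r.
have [/prefixP[z qE]|rq] := boolP (prefix r q).
  rewrite qE mx_unit_mull -?qE //; apply: mx_span_unit.
  by rewrite (permPl pq) qE perm_cat2r.
by rewrite mx_unit_mul0 //; exact: mx_span0.
Qed.

Lemma mx_spanM a b : mx_span a -> mx_span b -> mx_span (mx_mul a b).
Proof.
move=> sa sb; elim: sa => [|k p q c pq _ IH]; first by rewrite mx_0mul; exact: mx_span0.
rewrite mx_mulDl -mx_scaleAl; apply: mx_spanD => //; apply: mx_spanZ => {c IH}.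
elim: sb => [|l r s c rs _ IH]; first by rewrite mx_mul0; exact: mx_span0.
rewrite mx_mulDr -mx_scaleAr; apply: mx_spanD => //; apply: mx_spanZ.
exact: mx_span_unit_mul.
Qed.

Lemma mx_span_star a : mx_span a -> mx_span (mx_star a).
Proof.
elim=> [|k p q c pq _ IH].
  suff -> : mx_star (0 : blockmx) = 0 by exact: mx_span0.
  by apply/funext => u; apply/funext => v; exact: conjC0.
rewrite mx_starD mx_starZ mx_unit_star; apply: mx_spanS => //.
by rewrite perm_sym.
Qed.

Lemma mx_span_bound a : mx_span a -> exists2 M : R, 0 < M & mx_bound M a.
Proof.
elim=> [|k p q c pq _ [M M0 bM]]; first by exists 1 => //; exact: mx_bound0.
have k1 : 0 < normc k + 1 by rewrite ltr_wpDl ?normc_ge0.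
exists (normc k + 1 + M); first by rewrite addr_gt0.
apply: mx_boundD => //; apply: (@mx_boundW _ _ (normc k * 1)).
- by rewrite mulr1 normc_ge0.
- by rewrite mulr1 lerDl.
- by apply: mx_boundZ; exact: mx_unit_bound.
Qed.

(** The operator norm closure of the span. It is phrased with bounds because the norm, defined
    below, is meaningful only once some bound exists. *)
Definition mx_approximable a := forall e : R, 0 < e ->
  exists2 c, mx_span c & mx_bound e (a - c).

Lemma mx_span_approximable a : mx_span a -> mx_approximable a.
Proof. by move=> sa e e0; exists a => //; rewrite subrr; exact: mx_bound0. Qed.

Lemma mx_approximable_bound a : mx_approximable a -> exists2 M : R, 0 < M & mx_bound M a.
Proof.
move=> /(_ 1 ltr01) [c /mx_span_bound[M M0 bM] b1].
exists (1 + M); first by rewrite addr_gt0.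
by rewrite -(subrK c a); exact: mx_boundD.
Qed.

Lemma mx_approximableD a b : mx_approximable a -> mx_approximable b ->
  mx_approximable (a + b).
Proof.
move=> ha hb e e0; have e20 : 0 < e / 2 by rewrite divr_gt0.
have [c sc bc] := ha _ e20; have [d sd bd] := hb _ e20.
exists (c + d); first exact: mx_spanD.
by rewrite opprD addrACA [e]splitr; exact: mx_boundD.
Qed.

Lemma mx_approximableZ (k : C) a : mx_approximable a -> mx_approximable (k *: a).
Proof.
move=> ha e e0; have k1 : 0 < normc k + 1 by rewrite ltr_wpDl ?normc_ge0.
have [c sc bc] := ha _ (divr_gt0 e0 k1).
exists (k *: c); first exact: mx_spanZ.
rewrite -scalerBr; apply: mx_boundW (mx_boundZ k bc).
  by rewrite mulr_ge0 ?normc_ge0 // divr_ge0 // ltW.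
by rewrite mulrA ler_pdivrMr // mulrC ler_pM2l // lerDl.
Qed.

Lemma mx_approximableM a b : mx_approximable a -> mx_approximable b ->
  mx_approximable (mx_mul a b).
Proof.
move=> ha hb e e0; have e20 : 0 < e / 2 by rewrite divr_gt0.
have [M M0 bM] := mx_approximable_bound hb.
(* The order of choices matters: [c] is close to [a] relative to a bound of [b], then [d] is close
   to [b] relative to a bound of [c]. *)
have [c sc bc] := ha _ (divr_gt0 e20 M0).
have [N N0 bN] := mx_span_bound sc.
have [d sd bd] := hb _ (divr_gt0 e20 N0).
exists (mx_mul c d); first exact: mx_spanM.
have -> : mx_mul a b - mx_mul c d = mx_mul (a - c) b + mx_mul c (b - d).
  rewrite mx_mulDl mx_mulDr -[- d]scaleN1r -[- c]scaleN1r -mx_scaleAl -mx_scaleAr.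
  by rewrite !scaleN1r addrA subrK.
rewrite [e]splitr; apply: mx_boundD => //.
  by have := mx_boundM bc bM; rewrite divfK // gt_eqF.
by have := mx_boundM bN bd; rewrite mulrC divfK // gt_eqF.
Qed.

Lemma mx_approximable_star a : mx_approximable a -> mx_approximable (mx_star a).
Proof.
move=> ha e e0; have [c sc bc] := ha _ e0.
exists (mx_star c); first exact: mx_span_star.
have -> : mx_star a - mx_star c = mx_star (a - c).
  by rewrite mx_starD -[- c]scaleN1r mx_starZ rmorphN1 scaleN1r.
exact: mx_bound_star.
Qed.

(** The supremum of the operator norms of the blocks. For an unbounded matrix the set is empty and
    the infimum defaults to 0, so most lemmas on the norm assume [mx_approximable]. *)
Definition mx_norm a : R := inf [set M | 0 < M /\ mx_bound M a].

Lemma mx_norm_ge0 a : 0 <= mx_norm a.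
Proof.
rewrite /mx_norm; set S := [set _ | _]; have [->|/set0P S0] := eqVneq S set0.
  by rewrite inf0.
by apply: lb_le_inf => // M [/ltW].
Qed.

Lemma mx_norm_le a (M : R) : 0 < M -> mx_bound M a -> mx_norm a <= M.
Proof. by move=> M0 bM; apply: ge_inf => //; exists 0 => N [/ltW]. Qed.

Lemma mx_norm_bound a (M : R) : mx_approximable a -> mx_norm a < M -> mx_bound M a.
Proof.
move=> /mx_approximable_bound[N N0 bN] /inf_lt[|K [K0 bK] KM]; first by exists N.
by apply: mx_boundW bK; exact: ltW.
Qed.

(** The slack [e] avoids having to show that the infimum is attained; the norm inequalities below
    let it tend to 0. *)
Lemma mx_norm_boundD a (e : R) : mx_approximable a -> 0 < e ->
  0 < mx_norm a + e /\ mx_bound (mx_norm a + e) a.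
Proof.
move=> ha e0; split; first by rewrite ltr_wpDl ?mx_norm_ge0.
by apply: mx_norm_bound => //; rewrite ltrDl.
Qed.

Lemma mx_normD a b : mx_approximable a -> mx_approximable b ->
  mx_norm (a + b) <= mx_norm a + mx_norm b.
Proof.
move=> ha hb; apply/ler_addgt0Pr => e e0.
have e20 : 0 < e / 2 by rewrite divr_gt0.
have [M0 bM] := mx_norm_boundD ha e20; have [N0 bN] := mx_norm_boundD hb e20.
rewrite [e]splitr addrACA; apply: mx_norm_le; first exact: addr_gt0.
exact: mx_boundD.
Qed.

Lemma mx_norm_eq0 a : mx_approximable a -> mx_norm a = 0 -> a = 0.
Proof.
move=> ha a0; apply/funext => u; apply/funext => v; apply: eq0_normc.
apply/eqP; rewrite eq_le normc_ge0 andbT; apply/ler_addgt0Pr => e e0.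
have [M0 bM] := mx_norm_boundD ha e0; rewrite -a0.
by apply: mx_bound_entry => //; exact: ltW.
Qed.

Lemma mx_norm0 : mx_norm 0 = 0.
Proof.
apply/eqP; rewrite eq_le mx_norm_ge0 andbT; apply/ler_addgt0Pr => e e0.
by rewrite add0r; apply: mx_norm_le => //; exact: mx_bound0.
Qed.

Lemma mx_normZ_le (k : C) a : mx_approximable a ->
  mx_norm (k *: a) <= normc k * mx_norm a.
Proof.
move=> ha; have [->|k0] := eqVneq k 0.
  by rewrite scale0r mx_norm0 mulr_ge0 ?normc_ge0 ?mx_norm_ge0.
have nk0 : 0 < normc k.
  by rewrite lt_neqAle normc_ge0 andbT eq_sym; apply: contraNneq k0 => /eq0_normc ->.
apply/ler_addgt0Pr => e e0.
have [M0 bM] := mx_norm_boundD ha (divr_gt0 e0 nk0).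
have -> : normc k * mx_norm a + e = normc k * (mx_norm a + e / normc k).
  by rewrite mulrDr [_ * (_ / _)]mulrC divfK // gt_eqF.
by apply: mx_norm_le; [exact: mulr_gt0|exact: mx_boundZ].
Qed.

Lemma mx_normZ (k : C) a : mx_approximable a -> mx_norm (k *: a) = normc k * mx_norm a.
Proof.
move=> ha; apply/eqP; rewrite eq_le mx_normZ_le //=.
have [->|k0] := eqVneq k 0; first by rewrite normc0 mul0r mx_norm_ge0.
have nk0 : 0 < normc k.
  by rewrite lt_neqAle normc_ge0 andbT eq_sym; apply: contraNneq k0 => /eq0_normc ->.
have := mx_normZ_le k^-1 (mx_approximableZ k ha).
by rewrite scalerA mulVf // scale1r normcV mulrC ler_pdivlMr // mulrC.
Qed.

Lemma mx_normM a b : mx_approximable a -> mx_approximable b ->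
  mx_norm (mx_mul a b) <= mx_norm a * mx_norm b.
Proof.
move=> ha hb; set x := mx_norm a; set y := mx_norm b.
have x0 : 0 <= x by exact: mx_norm_ge0.
have y0 : 0 <= y by exact: mx_norm_ge0.
have h (e : R) : 0 < e -> mx_norm (mx_mul a b) <= (x + e) * (y + e).
  move=> e0; have [M0 bM] := mx_norm_boundD ha e0.
  have [N0 bN] := mx_norm_boundD hb e0.
  by apply: mx_norm_le; [exact: mulr_gt0|exact: mx_boundM].
apply/ler_addgt0Pr => e e0; have s0 : 0 < x + y + 1 by rewrite ltr_wpDl ?addr_ge0.
(* As d <= 1, the excess of (x + d) (y + d) over x y is d (x + y + d) <= d (x + y + 1) <= e. *)
pose d := Num.min 1 (e / (x + y + 1)).
have d0 : 0 < d by rewrite lt_min ltr01 divr_gt0.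
apply: (le_trans (h d d0)).
have d1 : d <= 1 by rewrite ge_min lexx.
have de : d * (x + y + 1) <= e by rewrite -ler_pdivlMr // ge_min lexx orbT.
by nra.
Qed.

Lemma mx_norm_star_le a : mx_approximable a -> mx_norm (mx_star a) <= mx_norm a.
Proof.
move=> ha; apply/ler_addgt0Pr => e e0; have [M0 bM] := mx_norm_boundD ha e0.
by apply: mx_norm_le => //; exact: mx_bound_star.
Qed.

(** One inequality is submultiplicativity together with the bound on the adjoint. For the other,
    [mx_bound_cstar] turns a bound K of the product into the bound sqrt K of [a]. *)
Lemma mx_norm_cstar a : mx_approximable a ->
  mx_norm (mx_mul (mx_star a) a) = mx_norm a ^+ 2.
Proof.
move=> ha; have hs := mx_approximable_star ha; have hm := mx_approximableM hs ha.
apply/eqP; rewrite eq_le; apply/andP; split.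
  apply: (le_trans (mx_normM hs ha)); rewrite expr2 ler_wpM2r ?mx_norm_ge0 //.
  exact: mx_norm_star_le.
apply/ler_addgt0Pr => e e0; have [K0 bK] := mx_norm_boundD hm e0.
rewrite -(sqr_sqrtr (ltW K0)) ler_sqr ?nnegrE ?mx_norm_ge0 ?sqrtr_ge0 //.
apply: mx_norm_le; first by rewrite sqrtr_gt0.
apply: mx_bound_cstar bK => //; first by rewrite sqr_sqrtr // ltW.
by have [N _ []] := mx_approximable_bound ha.
Qed.

End MatrixUnits.

(** * The normed space of approximable block matrices *)

Section BlockAlgebra.
Context (R : realType) (X : choiceType).
Local Notation C := R[i].
Local Notation word := (seq X).

(** The membership condition is made boolean so that the choice and module structures are inherited
    as those of a subtype. *)
Record blockalg := BlockAlg {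
  bmx :> blockmx R X;
  _ : `[< mx_approximable bmx >] }.

HB.instance Definition _ := [isSub for bmx].
HB.instance Definition _ := [Choice of blockalg by <:].

Lemma mx_approximable_subsemimod :
  subsemimod_closed [pred a : blockmx R X | `[< mx_approximable a >]].
Proof.
split; first split.
- by apply/asboolP; apply: mx_span_approximable; exact: mx_span0.
- by move=> a b /asboolP ha /asboolP hb; apply/asboolP; exact: mx_approximableD.
- by move=> k a /asboolP ha; apply/asboolP; exact: mx_approximableZ.
Qed.

HB.instance Definition _ := GRing.SubChoice_isSubLmodule.Build C (blockmx R X) _
  blockalg mx_approximable_subsemimod.

Lemma bmxP (a : blockalg) : mx_approximable a.
Proof. by apply/asboolP; case: a. Qed.

Definition blockalg_norm (a : blockalg) : C := (mx_norm a)%:C.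

Lemma blockalg_ler_normD a b :
  blockalg_norm (a + b) <= blockalg_norm a + blockalg_norm b.
Proof. by rewrite /blockalg_norm -rmorphD lecR; apply: mx_normD; exact: bmxP. Qed.

Lemma blockalg_normrZ (k : C) a : blockalg_norm (k *: a) = `|k| * blockalg_norm a.
Proof.
rewrite /blockalg_norm normr_complexE -rmorphM; congr _%:C.
by apply: mx_normZ; exact: bmxP.
Qed.

Lemma blockalg_normr0_eq0 a : blockalg_norm a = 0 -> a = 0.
Proof.
by move=> /complexI a0; apply: val_inj; apply: mx_norm_eq0 => //; exact: bmxP.
Qed.

HB.instance Definition _ := @Lmodule_isNormed.Build C blockalg
  blockalg_norm blockalg_ler_normD blockalg_normrZ blockalg_normr0_eq0.

End BlockAlgebra.

(** Positivity in the order of the complex numbers forces a zero imaginary part, so complex radii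
    reduce to real ones. *)
Lemma gt0_complexP (R : rcfType) (e : R[i]) : 0 < e -> exists2 r : R, 0 < r & e = r%:C.
Proof. by case: e => r i; rewrite ltcE /= => /andP[/eqP -> r0]; exists r. Qed.

(** * Completeness and the C*-algebra structure *)

Section BlockAlgebraComplete.
Context (R : realType) (X : choiceType).
Local Notation C := R[i].
Local Notation word := (seq X).
Local Notation A := (blockalg R X).

Lemma normc_ge_ReIm (z : C) : `|complex.Re z| <= normc z /\ `|complex.Im z| <= normc z.
Proof.
case: z => x y /=; split; rewrite -sqrtr_sqr; apply: ler_wsqrtr.
  by rewrite lerDl sqr_ge0.
by rewrite lerDr sqr_ge0.
Qed.

Lemma normc_le_ReIm (z : C) : normc z <= `|complex.Re z| + `|complex.Im z|.
Proof.
case: z => x y /=; rewrite -ler_sqr ?nnegrE ?sqrtr_ge0 ?addr_ge0 ?normr_ge0 //.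
rewrite sqr_sqrtr ?addr_ge0 ?sqr_ge0 // sqrrD !real_normK ?num_real //.
by rewrite lerD2r lerDl mulrn_wge0 // mulr_ge0.
Qed.

Lemma blockalg_normE (a : A) : `|a| = (mx_norm a)%:C.
Proof. by []. Qed.

Lemma normc_entry_le (a : A) u v : normc (bmx a u v) <= mx_norm a.
Proof.
apply/ler_addgt0Pr => e e0; have [M0 bM] := mx_norm_boundD (bmxP a) e0.
by apply: mx_bound_entry => //; exact: ltW.
Qed.

Lemma blockalg_ball (a b : A) (r : R) : ball a r%:C b <-> mx_norm (bmx a - bmx b) < r.
Proof. by rewrite -ball_normE /ball_ /= blockalg_normE ltcR. Qed.

(** Finite intersections suffice later because a block has finitely many entries. *)
Lemma near_all_seq (T : Type) (I : eqType) (F : set_system T) (P : I -> set T) (s : seq I) :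
  Filter F -> (forall i, i \in s -> F (P i)) -> F [set x | forall i, i \in s -> P i x].
Proof.
move=> FF; elim: s => [|i s IH] h.
  by apply: filterS filterT => x _ i; rewrite in_nil.
apply: filterS (filterI (h i (mem_head _ _))
  (IH (fun j js => h j (mem_behead (s := i :: s) js)))).
by move=> x [Pi Ps] j; rewrite inE => /orP[/eqP ->//|/Ps].
Qed.

Section CauchyFilter.
Variable F : set_system A.
Context {FF : ProperFilter F}.
Hypothesis Fc : cauchy F.

(** Meant for [g] the real or the imaginary part, which reduces the convergence of entries to the
    completeness of the reals. *)
Lemma cauchy_entry (g : C -> R) : (forall z, `|g z| <= normc z) ->
    (forall z w, g (z - w) = g z - g w) ->
  forall u v, cvg (g (bmx a u v) @[a --> F]).
Proof.
move=> gle gB u v; apply: R_complete; apply/cauchyP => e e0.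
have [a Fa] := (cauchyP F).1 Fc e%:C (eq_ind_r is_true e0 (ltcR 0 e)).
exists (g (bmx a u v)); rewrite /= /fmap /=; apply: filterS Fa => b /blockalg_ball ab.
rewrite -ball_normE /ball_ /= -gB; apply: (le_lt_trans (gle _)).
exact: le_lt_trans (normc_entry_le (a - b) u v) ab.
Qed.

Definition lim_mx : blockmx R X :=
  fun u v => (lim (complex.Re (bmx a u v) @[a --> F])) +i* (lim (complex.Im (bmx a u v) @[a --> F])).

Lemma near_lim_mx u v (e : R) : 0 < e ->
  \forall a \near F, normc (bmx a u v - lim_mx u v) < e.
Proof.
move=> e0; have e20 : 0 < e / 2 by rewrite divr_gt0.
have ReB (z w : C) : complex.Re (z - w) = complex.Re z - complex.Re w by case: z w => [? ?] [? ?].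
have ImB (z w : C) : complex.Im (z - w) = complex.Im z - complex.Im w by case: z w => [? ?] [? ?].
have /cvgrPdist_lt/(_ _ e20) hRe :=
  @cauchy_entry (@complex.Re R) (fun z => (normc_ge_ReIm z).1) ReB u v.
have /cvgrPdist_lt/(_ _ e20) hIm :=
  @cauchy_entry (@complex.Im R) (fun z => (normc_ge_ReIm z).2) ImB u v.
apply: filterS2 hRe hIm => a /= hRe hIm.
apply: (le_lt_trans (normc_le_ReIm _)).
by rewrite ReB ImB [e]splitr /= ![`|_ - lim _|]distrC ltrD.
Qed.

Lemma lim_mx_supp : block_supp lim_mx.
Proof.
move=> u v uv; apply: eq0_normc; apply/eqP; rewrite eq_le normc_ge0 andbT.
apply/ler_addgt0Pr => e e0; rewrite add0r.
have [a /=] := filter_ex (near_lim_mx u v e0).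
have [_ _ [sa _]] := mx_approximable_bound (bmxP a).
by rewrite sa // sub0r normcN => /ltW.
Qed.

(** Entrywise convergence becomes convergence in norm by going through an auxiliary [b], chosen
    after [u], [f] and [d]: it lies in the same Cauchy ball as [a], hence within e / 2 of [a], and
    is within [d] of the limit on the finitely many entries of the block of [u]. Since the ball was
    fixed beforehand, letting [d] tend to 0 gives a bound uniform in [u] and [f]. *)
Lemma near_lim_mx_bound (e : R) : 0 < e -> \forall a \near F, mx_bound e (bmx a - lim_mx).
Proof.
move=> e0; have e40 : 0 < e / 4 by rewrite divr_gt0.
have [a0 Fa0] := (cauchyP F).1 Fc (e / 4)%:C (eq_ind_r is_true e40 (ltcR 0 (e / 4))).
apply: filterS (Fa0) => a /blockalg_ball aa0; split.
  move=> u v uv; have [_ _ [sa _]] := mx_approximable_bound (bmxP a).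
  by rewrite mx_addE sa // add0r -[RHS](oppr0) -(lim_mx_supp uv).
move=> u f; set N := vsqnorm u f.
have N0 : 0 <= N by exact: vsqnorm_ge0.
(* A matrix with entries at most [d] on the block sends [f] to a vector of square norm at most d^2
   K, hence at most d K when d <= 1. *)
pose K := \sum_(w <- permutations u) (\sum_(v <- permutations u) normc (f v)) ^+ 2.
have K0 : 0 <= K by apply: sumr_ge0 => w _; exact: sqr_ge0.
suff h (d : R) : 0 < d -> d <= 1 ->
    vsqnorm u (mx_app (bmx a - lim_mx) f) <= 2 * (e / 2) ^+ 2 * N + 2 * (d * K).
  suff : vsqnorm u (mx_app (bmx a - lim_mx) f) <= 2 * (e / 2) ^+ 2 * N.
    by move=> /le_trans -> //; rewrite ler_wpM2r //; nra.
  apply/ler_addgt0Pr => d d0; pose d' := Num.min 1 (d / (2 * (K + 1))).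
  have K1 : 0 < 2 * (K + 1) by rewrite mulr_gt0 // ltr_wpDl.
  have d'0 : 0 < d' by rewrite lt_min ltr01 divr_gt0.
  apply: (le_trans (h d' d'0 _)); first by rewrite ge_min lexx.
  rewrite lerD2l; have : d' * (2 * (K + 1)) <= d.
    by rewrite -ler_pdivlMr // ge_min lexx orbT.
  by nra.
move=> d0 d1.
have Fs : \forall b \near F, forall w, w \in permutations u ->
    forall v, v \in permutations u -> normc (bmx b w v - lim_mx w v) < d.
  apply: near_all_seq => w _; apply: near_all_seq => v _; exact: near_lim_mx.
have [b [/blockalg_ball ba0 hb]] := filter_ex (filterI Fa0 Fs).
have bab : mx_bound (e / 2) (bmx a - bmx b).
  apply: (@mx_norm_bound _ _ (bmx (a - b))); first exact: bmxP.
  have -> : bmx (a - b) = bmx (a0 - b) - bmx (a0 - a).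
    by rewrite -[RHS]/(bmx ((a0 - b) - (a0 - a))); congr bmx; rewrite opprB [RHS]addrC addrA subrK.
  have -> : e / 2 = e / 4 + e / 4 by field.
  apply: (@le_lt_trans _ _ (mx_norm (bmx (a0 - b)) + mx_norm (bmx (a0 - a)))); last exact: ltrD.
  have := ler_normB (a0 - b) (a0 - a).
  by rewrite !blockalg_normE -rmorphD lecR.
have [_ /(_ u f) hab] := bab; rewrite -/N in hab.
apply: (@le_trans _ _ ((1 + 1) * vsqnorm u (mx_app (bmx a - bmx b) f) +
    (1 + 1^-1) * vsqnorm u (mx_app (bmx b - lim_mx) f))).
  rewrite /vsqnorm !mulr_sumr -big_split; apply: ler_sum => w _ /=.
  suff -> : mx_app (bmx a - lim_mx) f w =
      mx_app (bmx a - bmx b) f w + mx_app (bmx b - lim_mx) f w by exact: sqr_normcD.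
  rewrite /mx_app -big_split; apply: eq_bigr => v _.
  have -> : (bmx a - lim_mx) w v = (bmx a - bmx b) w v + (bmx b - lim_mx) w v.
    by rewrite -mx_addE addrA subrK.
  by rewrite mulrDl.
rewrite invr1; apply: lerD.
  by rewrite -[leRHS]mulrA; apply: (@ler_wpM2l _ 2).
apply: (@ler_wpM2l _ 2) => //; rewrite /K mulr_sumr /vsqnorm big_seq [leRHS]big_seq.
apply: ler_sum => w; rewrite mem_permutations => wu.
have hw : normc (mx_app (bmx b - lim_mx) f w) <=
    d * \sum_(v <- permutations u) normc (f v).
  rewrite /mx_app (sum_permutations _ wu); apply: (le_trans (normc_sum _ _)).
  rewrite mulr_sumr big_seq [leRHS]big_seq; apply: ler_sum => v vu.
  rewrite normcM ler_wpM2r ?normc_ge0 // ltW //.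
  by apply: hb => //; rewrite mem_permutations.
set s := \sum_(v <- _) _ in hw *.
have s0 : 0 <= s by apply: sumr_ge0 => v _; exact: normc_ge0.
apply: (@le_trans _ _ ((d * s) ^+ 2)).
  by rewrite ler_sqr ?nnegrE ?normc_ge0 // mulr_ge0 // ltW.
by rewrite exprMn ler_wpM2r ?sqr_ge0 // expr2; nra.
Qed.

Lemma lim_mx_approximable : mx_approximable lim_mx.
Proof.
move=> e e0; have e20 : 0 < e / 2 by rewrite divr_gt0.
have [a ba] := filter_ex (near_lim_mx_bound e20).
have [c sc bc] := bmxP a e20; exists c => //.
have -> : lim_mx - c = (bmx a - c) + (- 1) *: (bmx a - lim_mx).
  by rewrite scaleN1r opprB [RHS]addrC addrA subrK.
rewrite [e]splitr; apply: mx_boundD => //.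
by have := mx_boundZ (-1) ba; rewrite normcN normc1 mul1r.
Qed.

Lemma blockalg_cauchy_cvg : cvg F.
Proof.
have hl : `[< mx_approximable lim_mx >] by apply/asboolP; exact: lim_mx_approximable.
apply/cvg_ex; exists (BlockAlg hl).
apply/cvg_ballP => e /gt0_complexP[r r0 ->].
have r20 : 0 < r / 2 by rewrite divr_gt0.
apply: filterS (near_lim_mx_bound r20) => a ba.
apply: ball_sym; apply/blockalg_ball; apply: le_lt_trans (mx_norm_le r20 ba) _.
by rewrite ltr_pdivrMr // ltr_pMr // ltr1n.
Qed.

End CauchyFilter.

HB.instance Definition _ := Uniform_isComplete.Build A blockalg_cauchy_cvg.

Definition bmul (a b : A) : A :=
  BlockAlg (asboolT (mx_approximableM (bmxP a) (bmxP b))).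
Definition bstar (a : A) : A :=
  BlockAlg (asboolT (mx_approximable_star (bmxP a))).

Lemma bmx_supp (a : A) : block_supp a.
Proof. by have [? _ []] := mx_approximable_bound (bmxP a). Qed.

Lemma bmulA : associative bmul.
Proof. by move=> a b c; apply: val_inj; exact: mx_mulA. Qed.
Lemma bmulDl : left_distributive bmul +%R.
Proof. by move=> a b c; apply: val_inj; exact: mx_mulDl. Qed.
Lemma bmulDr : right_distributive bmul +%R.
Proof. by move=> a b c; apply: val_inj; exact: mx_mulDr. Qed.
Lemma bscaleAl (k : C) (a b : A) : k *: bmul a b = bmul (k *: a) b.
Proof. by apply: val_inj; exact: mx_scaleAl. Qed.
Lemma bscaleAr (k : C) (a b : A) : k *: bmul a b = bmul a (k *: b).
Proof. by apply: val_inj; exact: mx_scaleAr. Qed.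
Lemma bstarK : involutive bstar.
Proof. by move=> a; apply: val_inj; exact: mx_starK. Qed.
Lemma bstarD : {morph bstar : a b / a + b}.
Proof. by move=> a b; apply: val_inj; exact: mx_starD. Qed.
Lemma bstarZ (k : C) (a : A) : bstar (k *: a) = Num.conj k *: bstar a.
Proof. by apply: val_inj; exact: mx_starZ. Qed.
Lemma bstarM (a b : A) : bstar (bmul a b) = bmul (bstar b) (bstar a).
Proof. by apply: val_inj; apply: mx_starM; exact: bmx_supp. Qed.
Lemma bmul_norm_le (a b : A) : `|bmul a b| <= `|a| * `|b|.
Proof. by rewrite !blockalg_normE -rmorphM lecR; apply: mx_normM; exact: bmxP. Qed.
Lemma bcstar_identity (a : A) : `|bmul (bstar a) a| = `|a| ^+ 2.
Proof. by rewrite !blockalg_normE -rmorphXn mx_norm_cstar //; exact: bmxP. Qed.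

HB.instance Definition _ := CompleteNormedModule_isCStarAlgebra.Build R A
  bmulA bmulDl bmulDr bscaleAl bscaleAr bstarK bstarD bstarZ bstarM
  bmul_norm_le bcstar_identity.

End BlockAlgebraComplete.

(** * Finite spans and kernels of bounded maps *)

Section FiniteSpan.
Context (K : pzRingType) (V : lmodType K).
Implicit Types (l : seq V) (B : set V).

Definition lspan l : set V :=
  range (fun c : 'I_(size l) -> K => \sum_i c i *: l`_i).

Lemma submod_setP B : submod_closed (mem B) <->
  B 0 /\ forall k a b, B a -> B b -> B (k *: a + b).
Proof.
split=> -[B0 h]; split.
- by move: B0; rewrite inE.
- by move=> k a b Ba Bb; have := h k a b; rewrite !inE; apply.
- by rewrite inE.
- by move=> k a b; rewrite !inE; exact: h.
Qed.

Lemma lspan_submod l : lspan l 0 /\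
  forall k a b, lspan l a -> lspan l b -> lspan l (k *: a + b).
Proof.
split; first by exists (fun=> 0) => //; rewrite big1 // => i _; rewrite scale0r.
move=> k _ _ [c _ <-] [d _ <-]; exists (fun i => k * c i + d i) => //.
rewrite scaler_sumr -big_split; apply: eq_bigr => i _ /=.
by rewrite scalerDl scalerA.
Qed.

Lemma lspan_mem l x : x \in l -> lspan l x.
Proof.
move=> xl; have il : (index x l < size l)%N by rewrite index_mem.
exists (fun i => (i == Ordinal il)%:R) => //.
rewrite (bigD1 (Ordinal il)) //= eqxx scale1r nth_index //.
by rewrite big1 ?addr0 // => i /negPf ->; rewrite scale0r.
Qed.

Lemma lspan_min l B : submod_closed (mem B) -> (forall x, x \in l -> B x) ->
  lspan l `<=` B.
Proof.
move=> /submod_setP[B0 BD] lB _ [c _ <-].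
elim/big_ind : _ => // [a b Ba Bb|i _]; first by rewrite -[a]scale1r; exact: BD.
by rewrite -[_ *: _]addr0; apply: BD => //; apply: lB; exact: mem_nth.
Qed.

End FiniteSpan.

(** If [g a] is nonzero, the ball around [a] of radius |g a| / (M + 1) misses the kernel; the 1 is
    added to keep the divisor positive. *)
Lemma bounded_kernel_closed (K : numFieldType) (V W : normedModType K)
    (g : V -> W) (M : K) : {morph g : a b / a - b} -> 0 <= M ->
  (forall a, `|g a| <= M * `|a|) -> closed [set a | g a = 0].
Proof.
move=> gB M0 gM a cla /=; apply/eqP; rewrite -normr_eq0; apply/negPn/negP => n0.
have np : 0 < `|g a| by rewrite lt_neqAle eq_sym n0 normr_ge0.
have M1 : 0 < M + 1 by rewrite ltr_wpDl.
have e0 : 0 < `|g a| / (M + 1) by rewrite divr_gt0.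
have [b [/= gb]] := cla _ (nbhsx_ballx a _ e0); rewrite -ball_normE /= => ab.
have ga := gM (a - b); rewrite gB gb subr0 in ga.
have lt1 : (M + 1) * `|a - b| < `|g a| by rewrite mulrC -ltr_pdivlMr.
have le1 : M * `|a - b| <= (M + 1) * `|a - b| by rewrite mulrDl mul1r lerDl.
by have := le_lt_trans (le_trans ga le1) lt1; rewrite ltxx.
Qed.

Section CStarAlgebraZero.
Context (R : realType) (A : cstarAlgebraType R).

Lemma cmulr0 (a : A) : cmul a 0 = 0.
Proof. by have := cscaleAr 0 a 0; rewrite !scale0r. Qed.

Lemma cmul0r (a : A) : cmul 0 a = 0.
Proof. by have := cscaleAl 0 0 a; rewrite !scale0r. Qed.

Lemma star0 : star (0 : A) = 0.
Proof. by have := starZ 0 (0 : A); rewrite conjC0 !scale0r. Qed.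

End CStarAlgebraZero.

(** * Finite dimensional subalgebras spanned by matrix units, and the AF property *)

Section BlockAlgebraAF.
Context (R : realType) (X : choiceType).
Local Notation C := R[i].
Local Notation word := (seq X).
Local Notation A := (blockalg R X).
Implicit Types (a b : A) (p q r z u v w s t : word).

Lemma bmx_inj : injective (@bmx R X).
Proof. exact: val_inj. Qed.

Lemma bmxM a b : bmx (cmul a b) = mx_mul (bmx a) (bmx b).
Proof. by []. Qed.

Lemma bmxZ (k : C) a : bmx (k *: a) = k *: bmx a.
Proof. by []. Qed.

Lemma bmx_star a : bmx (star a) = mx_star (bmx a).
Proof. by []. Qed.

Lemma perm_unit_approximable p q :
  mx_approximable (if perm_eq p q then mx_unit R p q else 0).
Proof.
apply: mx_span_approximable; case: ifP => pq; first exact: mx_span_unit.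
exact: mx_span0.
Qed.

(** The value 0 on words that are not permutations of each other makes this a total function into
    the algebra. *)
Definition bunit p q : A := BlockAlg (asboolT (perm_unit_approximable p q)).

Lemma bunitE p q : perm_eq p q -> bmx (bunit p q) = mx_unit R p q.
Proof. by move=> pq /=; rewrite pq. Qed.

Lemma bunit_mulr p q r z : perm_eq p q -> perm_eq (q ++ z) r ->
  cmul (bunit p q) (bunit (q ++ z) r) = bunit (p ++ z) r.
Proof.
move=> pq qr; apply: bmx_inj; rewrite bmxM !bunitE //; first exact: mx_unit_mulr.
by rewrite -(permPr qr) perm_cat2r.
Qed.

Lemma bunit_mull p q r z : perm_eq p (q ++ z) -> perm_eq q r ->
  cmul (bunit p (q ++ z)) (bunit q r) = bunit p (r ++ z).
Proof.
move=> pq qr; apply: bmx_inj; rewrite bmxM !bunitE //; first exact: mx_unit_mull.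
by rewrite (permPl pq) perm_cat2r.
Qed.

Lemma bunit_mul p q r : perm_eq p q -> perm_eq q r ->
  cmul (bunit p q) (bunit q r) = bunit p r.
Proof.
by move=> pq qr; have := @bunit_mulr p q r [::]; rewrite !cats0; exact.
Qed.

Lemma bunit_mul0 p q r s : perm_eq p q -> perm_eq r s ->
  ~~ prefix q r -> ~~ prefix r q -> cmul (bunit p q) (bunit r s) = 0.
Proof.
by move=> pq rs qr rq; apply: bmx_inj; rewrite bmxM !bunitE //; exact: mx_unit_mul0.
Qed.

Lemma bunit_star p q : perm_eq p q -> star (bunit p q) = bunit q p.
Proof.
move=> pq; have qp : perm_eq q p by rewrite perm_sym.
by apply: bmx_inj; rewrite bmx_star !bunitE // mx_unit_star.
Qed.

Lemma mx_unit_diag p q : mx_unit R p q p q = 1.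
Proof. by rewrite /mx_unit prefix_refl drop_size cats0 eqxx. Qed.

Lemma bunit_neq0 p q : perm_eq p q -> bunit p q <> 0.
Proof.
move=> pq /(congr1 (fun a => bmx a p q)); rewrite /= pq mx_unit_diag.
by move/eqP; rewrite oner_eq0.
Qed.

(** Bounded projections onto finite dimensional subspaces, built by adding one vector at a time.
    Matrix entries serve as the bounded functionals that separate points, in place of
    Hahn-Banach. *)
Lemma lspan_projection (l : seq A) : exists (P : A -> A) (K : C),
  [/\ linear P, 0 <= K, forall a, `|P a| <= K * `|a|,
      forall a, lspan l (P a) & forall a, lspan l a -> P a = a].
Proof.
elim: l => [|x l [P [K [linP K0 Pb Pl lP]]]].
  exists (fun=> 0), 0; split=> //.
  - by move=> k a b; rewrite scaler0 addr0.
  - by move=> a; rewrite normr0 mul0r.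
  - by move=> a; exact: (lspan_submod [::]).1.
  - by move=> _ [c _ <-]; rewrite big_ord0.
have fixP (Q : A -> A) : linear Q -> submod_closed (mem [set a | Q a = a]).
  move=> linQ; apply/submod_setP; split=> [|k a b /= Qa Qb].
    by have := linQ (-1) 0 0; rewrite /= scaleN1r addNr scaleN1r addNr.
  by rewrite linQ Qa Qb.
have sub : lspan l `<=` lspan (x :: l).
  apply: lspan_min => [|y yl]; first by apply/submod_setP; exact: lspan_submod.
  by apply: lspan_mem; rewrite inE yl orbT.
have [xP|xP] := eqVneq (P x) x.
  exists P, K; split=> //; first by move=> a; apply: sub.
  apply: lspan_min; first exact: fixP.
  by move=> y; rewrite inE => /orP[/eqP -> //|yl]; apply: lP; exact: lspan_mem.
have [y yE] : exists y, y = x - P x by exists (x - P x).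
have [u [v yuv]] : exists u v, bmx y u v != 0.
  apply: contrapT => h; case/eqP: xP; apply/esym/eqP; rewrite -subr_eq0 -yE.
  apply/eqP; apply: bmx_inj; apply/funext => u; apply/funext => v.
  by apply/eqP; apply: contrapT => /negP yuv; apply: h; exists u, v.
have entD k a b w t : bmx (k *: a + b) w t = k * bmx a w t + bmx b w t by [].
have entB a b w t : bmx (a - b) w t = bmx a w t - bmx b w t by [].
(* The coefficient of [y] vanishes on the old span, where [P] is the identity, and is 1 at [x], so
   that Q x = P x + y = x. *)
pose Q a := P a + (bmx (a - P a) u v / bmx y u v) *: y.
have linQ : linear Q.
  move=> k a b; rewrite /Q linP !entB !entD.
  rewrite scalerDr scalerA addrACA -scalerDl; congr (_ + _ *: _).
  by field.
have Qb a : `|Q a| <= (K + (1 + K) / `|bmx y u v| * `|y|) * `|a|.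
  apply: (le_trans (ler_normD _ _)); rewrite [leRHS]mulrDl.
  apply: lerD; first exact: Pb.
  rewrite normrZ normrM normfV [leRHS]mulrAC; apply: ler_wpM2r => //.
  rewrite [leRHS]mulrAC; apply: ler_wpM2r; first by rewrite invr_ge0.
  apply: (@le_trans _ _ `|a - P a|).
    by rewrite normr_complexE blockalg_normE lecR normc_entry_le.
  by apply: (le_trans (ler_normB _ _)); rewrite mulrDl mul1r lerD2l.
exists Q, (K + (1 + K) / `|bmx y u v| * `|y|); split=> //.
- by rewrite addr_ge0 // mulr_ge0 // divr_ge0 // addr_ge0.
- have [_ h] := lspan_submod (x :: l); have hx := lspan_mem (mem_head x l).
  move=> a; rewrite /Q addrC; apply: (h); last exact: sub.
  by rewrite yE addrC -scaleN1r; apply: h => //; exact: sub.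
- apply: lspan_min; first exact: fixP.
  move=> b; rewrite inE => /orP[/eqP ->|bl] /=; rewrite /Q.
    by rewrite -yE divff // scale1r yE addrC subrK.
  by rewrite lP ?subrr ?mul0r ?scale0r ?addr0 //; exact: lspan_mem.
Qed.

(** The span is the kernel of the bounded map a - P a, for [P] a bounded projection onto it. *)
Lemma lspan_closed (l : seq A) : closed (lspan l).
Proof.
have [P [K [linP K0 Pb Pl lP]]] := lspan_projection l.
have linB a b : P (a - b) = P a - P b.
  by rewrite -[a - b]addrC -scaleN1r linP scaleN1r addrC.
suff -> : lspan l = [set a | a - P a = 0].
  apply: (@bounded_kernel_closed _ _ _ _ (1 + K)) => [a b||a]; last 2 first.
  - by rewrite addr_ge0.
  - by apply: (le_trans (ler_normB _ _)); rewrite mulrDl mul1r lerD2l.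
  - by rewrite linB !opprB addrACA [RHS]addrACA; congr (_ + _); rewrite addrC.
apply/seteqP; split=> a /=; first by move=> /lP ->; rewrite subrr.
by move=> /eqP; rewrite subr_eq0 => /eqP ->.
Qed.

Definition unit_list (l : seq word) : seq A :=
  [seq bunit p q | p <- flatten [seq permutations w | w <- l], q <- permutations p].

Lemma unit_listP l a : reflect
  (exists p q, [/\ has (perm_eq p) l, perm_eq p q & a = bunit p q]) (a \in unit_list l).
Proof.
apply: (iffP allpairsPdep) => -[p [q [h1 h2 ->]]]; exists p, q; split=> //.
- have /flatten_mapP[w wl pw] := h1; rewrite mem_permutations in pw.
  by apply/hasP; exists w.
- by move: h2; rewrite mem_permutations perm_sym.
- have /hasP[w wl pw] := h1; apply/flatten_mapP; exists w => //.
  by rewrite mem_permutations.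
- by rewrite mem_permutations perm_sym.
Qed.

Lemma has_perm l p q : perm_eq p q -> has (perm_eq q) l -> has (perm_eq p) l.
Proof. by move=> pq /hasP[w wl qw]; apply/hasP; exists w => //; rewrite (permPl pq). Qed.

(** A nonzero product of two units is a unit whose words are permutations of the longer of [q] and
    [r], so no permutation class outside [l] arises and the span stays finite dimensional. *)
Lemma unit_list_mul l p q r s : has (perm_eq p) l -> has (perm_eq r) l ->
  perm_eq p q -> perm_eq r s -> lspan (unit_list l) (cmul (bunit p q) (bunit r s)).
Proof.
move=> pl rl pq rs.
have [/prefixP[z rE]|qr] := boolP (prefix q r).
  subst r; rewrite bunit_mulr //; apply: lspan_mem; apply/unit_listP.
  have pzs : perm_eq (p ++ z) (q ++ z) by rewrite perm_cat2r.
  exists (p ++ z), s; split=> //; first exact: has_perm rl.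
  exact: perm_trans rs.
have [/prefixP[z qE]|rq] := boolP (prefix r q).
  subst q; rewrite bunit_mull //; apply: lspan_mem; apply/unit_listP.
  by exists p, (s ++ z); split=> //; rewrite (permPl pq) perm_cat2r.
by rewrite bunit_mul0 //; exact: (lspan_submod _).1.
Qed.

Lemma unit_list_subalgebra l : cstar_subalgebra (lspan (unit_list l)).
Proof.
have [L0 LD] := lspan_submod (unit_list l).
split; first exact: lspan_closed.
- exact/submod_setP.
- move=> a b La; move: b.
  apply: (@lspan_min _ _ _ [set b | lspan (unit_list l) (cmul a b)]).
    apply/submod_setP; split=> [|k b c /= hb hc].
      by rewrite /= cmulr0.
    by rewrite cmulDr -cscaleAr; exact: LD.
  move=> _ /unit_listP[r [s [rl rs ->]]]; move: a La.
  apply: (@lspan_min _ _ _ [set a | lspan (unit_list l) (cmul a (bunit r s))]).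
    apply/submod_setP; split=> [|k b c /= hb hc].
      by rewrite /= cmul0r.
    by rewrite cmulDl -cscaleAl; exact: LD.
  by move=> _ /unit_listP[p [q [pl pq ->]]]; exact: unit_list_mul.
- apply: (@lspan_min _ _ _ [set a | lspan (unit_list l) (star a)]).
    apply/submod_setP; split=> [|k b c /= hb hc].
      by rewrite /= star0.
    by rewrite starD starZ; exact: LD.
  move=> _ /unit_listP[p [q [pl pq ->]]] /=; rewrite bunit_star //.
  apply: lspan_mem; apply/unit_listP; exists q, p; rewrite perm_sym; split=> //.
  by apply: has_perm pl; rewrite perm_sym.
Qed.

Lemma unit_list_sub l1 l2 : {subset l1 <= l2} ->
  lspan (unit_list l1) `<=` lspan (unit_list l2).
Proof.
move=> l12; apply: lspan_min => [|_ /unit_listP[p [q [pl pq ->]]]].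
  exact/submod_setP/lspan_submod.
apply: lspan_mem; apply/unit_listP; exists p, q; split=> //.
by have /hasP[w /l12 wl pw] := pl; apply/hasP; exists w.
Qed.

Lemma mx_span_lspan (c : blockmx R X) : mx_span c ->
  exists l a, lspan (unit_list l) a /\ bmx a = c.
Proof.
elim=> [|k p q {}c pq _ [l [a [la <-]]]].
  by exists [::], 0; split=> //; exact: (lspan_submod _).1.
exists (p :: l), (k *: bunit p q + a); split; last by rewrite -bunitE.
apply: (lspan_submod _).2; last first.
  by apply: unit_list_sub la => w wl; rewrite inE wl orbT.
apply: lspan_mem; apply/unit_listP; exists p, q; split=> //.
by rewrite /= perm_refl.
Qed.

Lemma lspan_dense a (e : R) : 0 < e ->
  exists l b, lspan (unit_list l) b /\ ball a e%:C b.
Proof.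
move=> e0; have e20 : 0 < e / 2 by rewrite divr_gt0.
have [c /mx_span_lspan[l [b [lb <-]]] bc] := bmxP a e20.
exists l, b; split=> //; apply/blockalg_ball; apply: le_lt_trans (mx_norm_le e20 bc) _.
by rewrite ltr_pdivrMr // ltr_pMr // ltr1n.
Qed.

Lemma blockalg_AF : AF_algebra A.
Proof.
exists [set B | exists l, B = lspan (unit_list l)]; split.
- move=> _ [l ->]; split; first exact: unit_list_subalgebra.
  by exists (size (unit_list l)), (fun i => (unit_list l)`_i).
- move=> _ _ [l1 ->] [l2 ->]; exists (lspan (unit_list (l1 ++ l2))); split.
  + by exists (l1 ++ l2).
  + by apply: unit_list_sub => w wl; rewrite mem_cat wl.
  + by apply: unit_list_sub => w wl; rewrite mem_cat wl orbT.
- move=> O [a Oa] oO; have /nbhs_ballP[e /= /gt0_complexP[r r0 ->] aO] := open_nbhs_nbhs (conj oO Oa).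
  have [l [b [lb ab]]] := lspan_dense a r0.
  exists b; split; first exact: aO.
  by exists (lspan (unit_list l)) => //; exists l.
Qed.

(** Density as an induction principle: a property cutting out a closed subspace need only be checked
    on matrix units. *)
Lemma bunit_total (V : set A) : closed V -> submod_closed (mem V) ->
  (forall p q, perm_eq p q -> V (bunit p q)) -> forall a, V a.
Proof.
move=> cV sV hV a; apply: cV => B /nbhs_ballP[e /= /gt0_complexP[r r0 ->] aB].
have [l [b [lb ab]]] := lspan_dense a r0.
exists b; split; last exact: aB.
by apply: lspan_min lb => // _ /unit_listP[p [q [_ pq ->]]]; exact: hV.
Qed.

End BlockAlgebraAF.

(** * Fresh letters, primeness and non-separability *)

Section FreshLetter.
Context (R : realType) (X : choiceType).
Hypothesis uncountableX : ~ countable [set: X].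
Local Notation C := R[i].
Local Notation word := (seq X).
Local Notation A := (blockalg R X).
Implicit Types (a b : A) (p q r z u v w s t : word) (x y : X).

(** A prefix [p] that avoids [x] cannot reach the displayed [x], so it is a prefix of [w]. As [w]
    and [u] have equal sizes, the equation between the columns splits at that letter. *)
Lemma mx_unit_fresh p q x w u z z' : perm_eq p q -> x \notin p -> size w = size u ->
  mx_unit R p q (w ++ x :: z) (u ++ x :: z') =
  if z == z' then mx_unit R p q w u else 0.
Proof.
move=> pq xp wu; rewrite /mx_unit; have [/prefixP[y wE]|pw] := boolP (prefix p w).
  subst w; rewrite -catA prefix_prefix !drop_size_cat // catA /= eqseq_cat; last first.
    by rewrite -wu !size_cat (perm_size pq).
  by rewrite eqseq_cons eqxx [z' == z]eq_sym; case: (z == z'); rewrite ?andbT ?andbF.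
suff /negPf -> : ~~ prefix p (w ++ x :: z) by case: ifP.
apply/negP => /prefixP[y].
have [le|lt] := leqP (size p) (size w) => /(congr1 (take (size p))).
  rewrite (take_size_cat y (erefl (size p))) takel_cat // => pE.
  by case/negP: pw; apply/prefixP; exists (drop (size p) w); rewrite -{1}pE cat_take_drop.
rewrite (take_size_cat y (erefl (size p))) take_cat ltnNge ltnW //= => pE.
case/negP: xp; rewrite -pE; move: lt; rewrite -subn_gt0.
by case: (_ - _)%N => // k _; rewrite mem_cat /= mem_head orbT.
Qed.

Lemma mx_span_fresh (c : blockmx R X) : mx_span c -> exists l : seq X,
  forall x, x \notin l -> forall w u z z', size w = size u ->
  c (w ++ x :: z) (u ++ x :: z') = if z == z' then c w u else 0.
Proof.
elim=> [|k p q {}c pq _ [l IH]]; first by exists [::] => *; case: ifP.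
exists (p ++ l) => x; rewrite mem_cat negb_or => /andP[xp xl] w u z z' wu.
rewrite !mx_addE !mx_scaleE mx_unit_fresh // IH //.
by case: ifP => // _; rewrite mulr0 addr0.
Qed.

(* The approximants of [a] from the span of the units involve only countably
   many letters altogether. *)
Lemma fresh_letter a : exists x, forall w u z z', size w = size u ->
  bmx a (w ++ x :: z) (u ++ x :: z') = if z == z' then bmx a w u else 0.
Proof.
have happ n : exists cl : blockmx R X * seq X,
    mx_bound n.+1%:R^-1 (bmx a - cl.1) /\
    forall x, x \notin cl.2 -> forall w u z z', size w = size u ->
    cl.1 (w ++ x :: z) (u ++ x :: z') = if z == z' then cl.1 w u else 0.
  have n0 : 0 < n.+1%:R^-1 :> R by rewrite invr_gt0 ltr0n.
  have [c sc bc] := bmxP a n0; have [l hl] := mx_span_fresh sc.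
  by exists (c, l).
have [cl hcl] := choice happ.
have [x xP] : exists x, forall n, x \notin (cl n).2.
  apply: contrapT => h; apply: uncountableX.
  have -> : [set: X] = \bigcup_n [set` (cl n).2].
    apply/seteqP; split=> // x _; apply: contrapT => hx; apply: h; exists x => n.
    by apply/negP => xn; apply: hx; exists n.
  by apply: bigcup_countable => // n _; exact: finite_set_countable.
exists x => w u z z' wu; set rhs := if _ then _ else _.
apply/eqP; rewrite -subr_eq0; apply/eqP/eq0_normc; apply/eqP.
rewrite eq_le normc_ge0 andbT; apply/ler_addgt0Pr => e e0; rewrite add0r.
(* Both entries of [a] are within 1 / (n + 1) of those of its approximant, which accounts for the
   sum of two such terms. *)
pose n := Num.bound (2 / e).
have ne : n.+1%:R^-1 + n.+1%:R^-1 <= e :> R.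
  have -> : n.+1%:R^-1 + n.+1%:R^-1 = 2 / n.+1%:R :> R by rewrite mulrDl mul1r.
  rewrite ler_pdivrMr ?ltr0n // mulrC -ler_pdivrMr //.
  rewrite ltW // (lt_trans (archi_boundP _)) ?ltr_nat // divr_ge0 // ltW //.
apply: le_trans ne; have [bn hn] := hcl n.
have n0 : 0 <= n.+1%:R^-1 :> R by rewrite invr_ge0.
have h1 := mx_bound_entry (w ++ x :: z) (u ++ x :: z') n0 bn.
have h2 := mx_bound_entry w u n0 bn.
have := hn _ (xP n) w u z z' wu.
set c := (cl n).1 in h1 h2 * => cE.
have {}h1 : normc (bmx a (w ++ x :: z) (u ++ x :: z') - c (w ++ x :: z) (u ++ x :: z'))
  <= n.+1%:R^-1 by exact: h1.
have {}h2 : normc (c w u - bmx a w u) <= n.+1%:R^-1 by rewrite -normcN opprB; exact: h2.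
rewrite cE in h1; rewrite /rhs; case: ifP h1 => _ h1.
  have -> : bmx a (w ++ x :: z) (u ++ x :: z') - bmx a w u =
    (bmx a (w ++ x :: z) (u ++ x :: z') - c w u) + (c w u - bmx a w u).
    by rewrite addrA subrK.
  exact: le_trans (le_normcD _ _) (lerD h1 h2).
by apply: (le_trans h1); rewrite lerDl.
Qed.

(** Obtained from left multiplication by a unit through adjoints. *)
Lemma mx_mul_unit_diag (a : blockmx R X) q s t : block_supp a ->
  mx_mul a (mx_unit R q q) s t = if prefix q t then a s t else 0.
Proof.
move=> sa; rewrite -[mx_mul _ _]mx_starK mx_starM //; last exact: mx_unit_supp.
rewrite {1}/mx_star mx_unit_star mx_unit_mulE //.
case: ifP => [/prefixP[z ->]|_]; last exact: conjC0.
by rewrite drop_size_cat // /mx_star conjCK.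
Qed.

(** The cut leaves the entries of [a] at [w ++ x :: z] and [u ++ x :: z'], which by the choice of
    [x] are [a w u] when z = z' and 0 otherwise. *)
Lemma fresh_corner a : exists x, forall w u, perm_eq w u ->
  cmul (cmul (bunit R (w ++ [:: x]) (w ++ [:: x])) a)
    (bunit R (u ++ [:: x]) (u ++ [:: x])) =
  bmx a w u *: bunit R (w ++ [:: x]) (u ++ [:: x]).
Proof.
have [x hx] := fresh_letter a; exists x => w u wu; apply: bmx_inj; rewrite !bmxM bmxZ.
have wxux : perm_eq (w ++ [:: x]) (u ++ [:: x]) by rewrite perm_cat2r.
apply/funext => s; apply/funext => t; rewrite !bunitE // -mx_mulA mx_unit_mulE //.
rewrite mx_mul_unit_diag; last exact: bmx_supp.
rewrite mx_scaleE /mx_unit; case: prefixP => [[z ->]|_] /=; last by rewrite mulr0.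
rewrite drop_size_cat //=.
case: prefixP => [[z' ->]|ux].
  rewrite -!catA /= hx; last exact: perm_size.
  rewrite eqseq_cat // eqxx /= eqseq_cons eqxx /= [z' == z]eq_sym.
  by case: ifP; rewrite ?mulr1 ?mulr0.
by case: eqP => [tE|]; rewrite ?mulr0 //; case: ux; exists z.
Qed.

Lemma ideal_bunit (I : set A) : closed_ideal I -> I <> [set 0] ->
  exists p, I (bunit R p p).
Proof.
move=> [_ /submod_setP[I0 ID] IL IR] In0.
have [a Ia a0] : exists2 a, I a & a <> 0.
  apply: contrapT => h; apply: In0; apply/seteqP; split=> [a Ia|_ ->] //=.
  by apply: contrapT => a0; apply: h; exists a.
have [w [u awu]] : exists w u, bmx a w u != 0.
  apply: contrapT => h; apply: a0; apply: bmx_inj.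
  apply/funext => w; apply/funext => u.
  by apply/eqP; apply: contrapT => /negP awu; apply: h; exists w, u.
have wu : perm_eq w u.
  by apply: contrapT => /negP /(bmx_supp a) /eqP; rewrite (negPf awu).
have [x /(_ w u wu) hx] := fresh_corner a.
have wxux : perm_eq (w ++ [:: x]) (u ++ [:: x]) by rewrite perm_cat2r.
have uxwx : perm_eq (u ++ [:: x]) (w ++ [:: x]) by rewrite perm_sym.
have Iwu : I (bunit R (w ++ [:: x]) (u ++ [:: x])).
  rewrite -[bunit R _ _]scale1r -(mulVf awu) -scalerA -[_ *: (_ *: _)]addr0 -hx.
  by apply: ID => //; apply: IR; apply: IL.
(* Multiplying on the right by the unit from [u ++ [:: x]] back to [w ++ [:: x]] makes it
   diagonal. *)
by exists (w ++ [:: x]); rewrite -(bunit_mul R wxux uxwx); exact: IR.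
Qed.

Lemma blockalg_prime : prime_algebra A.
Proof.
move=> I J hI hJ /(ideal_bunit hI)[p Ip] /(ideal_bunit hJ)[q Jq] IJ.
have [_ _ _ IR] := hI; have [_ _ JL _] := hJ.
have pq : perm_eq (p ++ q) (q ++ p) by rewrite perm_catC.
suff : (I `&` J) (bunit R (p ++ q) (q ++ p)) by rewrite IJ; exact: bunit_neq0.
split.
  (* The unit absorbs [E p p] on its left, because its row word begins with [p], and [E q q] on its
     right, because its column word begins with [q]. *)
  by rewrite -(@bunit_mulr R X p p (q ++ p) q) //; exact: IR.
by rewrite -(@bunit_mull R X (p ++ q) q q p) //; exact: JL.
Qed.

(** The projections [e x] are at mutual distance at least 1, as the entry at the word [[:: x]]
    shows. The balls of radius 1/2 around them are thus disjoint, and a dense set meets each. *)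
Lemma blockalg_nonseparable : ~ separable_space A.
Proof.
move=> [D [cD dD]]; pose e x : A := bunit R [:: x] [:: x].
have h20 : 0 < 2^-1 :> R by rewrite invr_gt0.
have hd x : exists d, D d /\ ball (e x) (2^-1)%:C d.
  have i0 : (ball (e x) (2^-1)%:C)^° !=set0.
    by exists (e x); apply: nbhsx_ballx; rewrite ltcR.
  have [d [bd Dd]] := dD _ i0 (@open_interior _ _).
  by exists d; split=> //; exact: interior_subset bd.
have [d dP] := choice hd.
have /countable_injP[f finj] := cD.
apply: uncountableX; apply/countable_injP; exists (f \o d) => x y _ _ /= fxy.
have dxy : d x = d y by apply: finj fxy; rewrite inE; exact: (dP _).1.
apply: contrapT => /eqP xy.
have h1 : mx_norm (bmx (e x - d x)) < 2^-1 by exact/blockalg_ball/(dP x).2.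
have h2 : mx_norm (bmx (d x - e y)) < 2^-1.
  by rewrite dxy; apply/blockalg_ball/ball_sym; exact: (dP y).2.
have := ler_normD (e x - d x) (d x - e y).
rewrite addrA subrK !blockalg_normE -rmorphD lecR.
move=> /le_lt_trans /(_ (ltrD h1 h2)); apply/negP; rewrite -leNgt.
have := normc_entry_le (e x - e y) [:: x] [:: x].
have -> : bmx (e x - e y) [:: x] [:: x] = 1.
  rewrite -[LHS]/(bmx (e x) [:: x] [:: x] - bmx (e y) [:: x] [:: x]).
  rewrite !bunitE // mx_unit_diag /mx_unit /= eqseq_cons eq_sym (negPf xy).
  by rewrite subr0.
rewrite normc1; apply: le_trans; have -> : 2^-1 + 2^-1 = 1 :> R by field.
by [].
Qed.

End FreshLetter.

(** * Continuity of representations of a C*-algebra and Bessel's inequality *)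

Section RepresentationBound.
Context (R : realType) (A : cstarAlgebraType R).
Local Notation C := R[i].
Implicit Types (a b c : A).

Lemma cmulrB a b c : cmul a (b - c) = cmul a b - cmul a c.
Proof. by rewrite cmulDr -[- c]scaleN1r -cscaleAr scaleN1r. Qed.

Lemma cmulBr a b c : cmul (a - b) c = cmul a c - cmul b c.
Proof. by rewrite cmulDl -[- b]scaleN1r -cscaleAl scaleN1r. Qed.

Lemma starB a b : star (a - b) = star a - star b.
Proof. by rewrite starD -[- b]scaleN1r starZ rmorphN1 scaleN1r. Qed.

Lemma norm_star a : `|star a| = `|a|.
Proof.
suff h b : `|b| <= `|star b|.
  by apply/eqP; rewrite eq_le -{2}(starK a) !h.
have [->|b0] := eqVneq `|b| 0; first exact: normr_ge0.
have bp : 0 < `|b| by rewrite lt_neqAle eq_sym b0 normr_ge0.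
by rewrite -(ler_pM2r bp) -expr2 -cstar_identity cmul_norm_le.
Qed.

Lemma near_eq0 (V : normedModType C) (x : V) (M : C) : 0 <= M ->
  (forall e : C, 0 < e -> `|x| <= M * e) -> x = 0.
Proof.
move=> M0 h; apply/eqP; rewrite -normr_eq0; apply/negPn/negP => n0.
have np : 0 < `|x| by rewrite lt_neqAle eq_sym n0 normr_ge0.
have M1 : 0 < M + 1 by rewrite ltr_wpDl.
have e0 : 0 < `|x| / (M + 1) by rewrite divr_gt0.
have lt1 : M * (`|x| / (M + 1)) < `|x|.
  by rewrite mulrA ltr_pdivrMr // mulrC ltr_pM2l // ltrDl.
by have := le_lt_trans (h _ e0) lt1; rewrite ltxx.
Qed.

Lemma half_pow_lt (e : C) : 0 < e -> exists n, 2^-1 ^+ n < e.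
Proof.
move=> /gt0_complexP[r r0 ->]; exists (Num.bound r^-1).
have -> : 2^-1 = (2^-1)%:C :> C by rewrite fmorphV rmorphMn.
rewrite -rmorphXn ltcR exprVn -[ltRHS]invrK ltf_pV2 ?posrE ?invr_gt0 ?exprn_gt0 //.
apply: lt_trans (archi_boundP _) _; first by rewrite invr_ge0 ltW.
by rewrite -natrX ltr_nat ltn_expl.
Qed.

(* The element [1 - sqrt (1 - c)] of a possibly non-unital algebra, obtained by
   iterating the contraction [b |-> (c + b^2) / 2] of the ball of radius 1/2. *)
Lemma cstar_sqrt c : star c = c -> `|c| <= 2^-1 ->
  exists2 b, star b = b & b + b - cmul b b = c.
Proof.
move=> sc nc; pose f b := 2^-1 *: (c + cmul b b).
pose u n := iter n f 0.
have n20 : 0 < 2^-1 :> C by rewrite invr_gt0.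
have half2 : 2^-1 + 2^-1 = 1 :> C by field.
have nf b b' : `|f b - f b'| <= 2^-1 * ((`|b| + `|b'|) * `|b - b'|).
  rewrite /f -scalerBr normrZ gtr0_norm // ler_pM2l //.
  have -> : c + cmul b b - (c + cmul b' b') = cmul b (b - b') + cmul (b - b') b'.
    by rewrite cmulrB cmulBr opprD addrACA subrr add0r addrA subrK.
  apply: (le_trans (ler_normD _ _)); rewrite mulrDl; apply: lerD.
    exact: cmul_norm_le.
  by rewrite mulrC; exact: cmul_norm_le.
have nu n : `|u n| <= 2^-1.
  elim: n => [|n IH]; first by rewrite normr0 ltW.
  rewrite /= -/(u n) /f normrZ gtr0_norm // -[leRHS]mulr1 ler_pM2l //.
  apply: (le_trans (ler_normD _ _)); rewrite -half2; apply: lerD => //.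
  apply: (le_trans (cmul_norm_le _ _)); rewrite -[leRHS]mulr1.
  apply: ler_pM => //; apply: (le_trans IH).
  by rewrite invf_le1 // ler1n.
(* By [nu] the sum of norms in [nf] is at most 1 on the iterates, so each step halves the
   distance. *)
have du n k : `|u (n + k)%N - u n| <= 2^-1 ^+ n.
  elim: n => [|n IH]; first by rewrite subr0 expr0 (le_trans (nu _)) // invf_le1 // ler1n.
  rewrite addSn /= -/(u _) -/(u n) exprS; apply: (le_trans (nf _ _)).
  rewrite ler_pM2l // -[leRHS]mul1r; apply: ler_pM => //; first by rewrite addr_ge0.
  by rewrite -half2 lerD.
have cvu : cvg (u n @[n --> \oo]).
  apply: cauchy_cvg; apply/cauchyP => e /half_pow_lt[n ne]; exists (u n).
  exists n => // m /= nm; rewrite -ball_normE /= distrC.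
  by apply: le_lt_trans ne; rewrite -(subnKC nm).
have [b ub] : exists b, u n @[n --> \oo] --> b by apply/cvg_ex.
have approx e : 0 < e -> exists n, `|b - u n| < e /\ `|b - u n.+1| < e.
  move=> e0; move/cvgrPdist_lt : ub => /(_ _ e0)[N _ hN].
  by exists N; split; apply: hN => /=.
have su n : star (u n) = u n.
  elim: n => [|n IH]; first exact: star0.
  by rewrite /= -/(u n) /f starZ starD starM sc IH geC0_conj // ltW.
have sb : star b = b.
  apply/eqP; rewrite -subr_eq0; apply/eqP; apply: (@near_eq0 _ _ 2) => // e e0.
  have [n [bn _]] := approx e e0.
  have -> : star b - b = star (b - u n) - (b - u n).
    by rewrite starB su opprB addrA subrK.
  apply: (le_trans (ler_normB _ _)).
  by rewrite norm_star mulrDl mul1r lerD // ltW.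
exists b => //.
(* A crude bound, meant only to make the Lipschitz constant of [f] between [b] and the iterates
   explicit. *)
have nb : `|b| <= 1 + 2^-1.
  have [n [bn _]] := approx 1 ltr01; rewrite -(subrK (u n) b).
  by apply: (le_trans (ler_normD _ _)); apply: lerD => //; exact: ltW.
have fb : f b - b = 0.
  apply: (@near_eq0 _ _ (2^-1 * (1 + 2^-1 + 2^-1) + 1)) => [|e e0].
    have h0 := ltW n20; apply: addr_ge0 => //; apply: mulr_ge0 => //.
    by apply: addr_ge0 => //; exact: addr_ge0.
  have [n [bn bn1]] := approx e e0.
  have -> : f b - b = (f b - f (u n)) - (b - u n.+1).
    by rewrite /= -/(u n) opprB addrA subrK.
  apply: (le_trans (ler_normB _ _)); rewrite mulrDl mul1r; apply: lerD; last exact: ltW.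
  apply: (le_trans (nf _ _)); rewrite -mulrA ler_pM2l //.
  by apply: ler_pM; rewrite ?addr_ge0 ?lerD // ltW.
(* The claim is the fixed point equation b = (c + b^2) / 2, doubled. *)
move/eqP: fb; rewrite subr_eq0 => /eqP fb; rewrite -{1 2}fb /f -scalerDl half2 scale1r.
by rewrite addrK.
Qed.

Variables (H : hilbertSpace R) (pi : A -> H -> H).
Hypothesis repr : star_representation pi.

Lemma reprD a b x : pi (a + b) x = pi a x + pi b x.
Proof. by have [_ h _ _] := repr; have := h 1 a b x; rewrite !scale1r. Qed.

Lemma repr0 x : pi 0 x = 0.
Proof. by apply: (addrI (pi 0 x)); rewrite -reprD !addr0. Qed.

Lemma reprZ (k : C) a x : pi (k *: a) x = k *: pi a x.
Proof. by have [_ h _ _] := repr; rewrite -[k *: a]addr0 h repr0 addr0. Qed.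

Lemma reprB a b x : pi (a - b) x = pi a x - pi b x.
Proof. by rewrite reprD -[- b]scaleN1r reprZ scaleN1r. Qed.

Lemma reprM a b x : pi (cmul a b) x = pi a (pi b x).
Proof. by have [_ _ h _] := repr; exact: h. Qed.

Lemma repr_linear a : linear (pi a).
Proof. by have [h _ _ _] := repr; exact: (h a).1. Qed.

Lemma repr_adjoint a x y : inner (pi a x) y = inner x (pi (star a) y).
Proof. by have [_ _ _ h] := repr; exact: h. Qed.

Lemma repr_sub_vec a x y : pi a (x - y) = pi a x - pi a y.
Proof. by rewrite addrC -scaleN1r repr_linear scaleN1r addrC. Qed.

Lemma repr_vec0 a : pi a 0 = 0.
Proof. by rewrite -(subrr 0) repr_sub_vec !subrr. Qed.

Lemma repr_sqrnorm a x : `|pi a x| ^+ 2 = inner x (pi (cmul (star a) a) x).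
Proof. by rewrite -inner_norm repr_adjoint reprM. Qed.

(** Writing c = 2 b - b^2 for c the product of the adjoint of [a] with [a], formally 1 - c = (1 -
    b)^2. Hence |x|^2 - |pi a x|^2 is the square norm of x - pi b x, which makes sense without a
    unit. *)
Lemma repr_half_contraction a x : `|a| <= 2^-1 -> `|pi a x| <= `|x|.
Proof.
move=> na; pose c := cmul (star a) a.
have sc : star c = c by rewrite /c starM starK.
have nc : `|c| <= 2^-1.
  rewrite /c cstar_identity expr2 -[leRHS]mulr1; apply: ler_pM => //.
  by apply: (le_trans na); rewrite invf_le1 // ler1n.
have [b sb bc] := cstar_sqrt sc nc.
rewrite -ler_sqr ?nnegrE // repr_sqrnorm -/c -subr_ge0.
suff -> : `|x| ^+ 2 - inner x (pi c x) = `|x - pi b x| ^+ 2 by rewrite exprn_ge0.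
rewrite -!inner_norm -bc reprB reprD reprM.
have bb : inner (pi b x) (pi b x) = inner x (pi b (pi b x)).
  by rewrite repr_adjoint sb.
have bx : inner (pi b x) x = inner x (pi b x) by rewrite repr_adjoint sb.
rewrite linearBl !linearBr /= linearDr /= bb bx.
by rewrite !opprB !opprD !addrA; ring.
Qed.

(** Rescaling [a] to norm 1/2 costs the factor 2. Continuity in [a] is not part of the definition of
    a representation and is derived here; it makes annihilators closed. *)
Lemma repr_bound a x : `|pi a x| <= 2 * `|x| * `|a|.
Proof.
have [->|a0] := eqVneq a 0; first by rewrite repr0 !normr0 mulr0.
have ap : 0 < `|a| by rewrite normr_gt0.
pose k := 2 * `|a|; have k0 : 0 < k by rewrite mulr_gt0.
have -> : pi a x = k *: pi (k^-1 *: a) x.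
  by rewrite reprZ scalerA divff ?scale1r // gt_eqF.
rewrite normrZ gtr0_norm // /k mulrAC ler_pM2r // ler_pM2l //.
apply: repr_half_contraction; rewrite normrZ gtr0_norm ?invr_gt0 // invfM.
by rewrite -mulrA mulVf ?mulr1 // gt_eqF.
Qed.

Lemma repr_annihilator_closed x b : closed [set a | pi (cmul b a) x = 0].
Proof.
apply: (@bounded_kernel_closed _ _ _ _ (2 * `|x| * `|b|)) => [a c||a].
- by rewrite cmulrB reprB.
- by rewrite !mulr_ge0.
- apply: (le_trans (repr_bound _ _)); rewrite -[leRHS]mulrA; apply: ler_wpM2l.
    by rewrite mulr_ge0.
  exact: cmul_norm_le.
Qed.

Definition orthogonal_projections (T : eqType) (e : T -> A) (s : seq T) :=
  forall v w, v \in s -> w \in s ->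
    star (e v) = e v /\ cmul (e v) (e w) = if v == w then e v else 0.

(** Split off one projection: [x] is the orthogonal sum of [pi (e v) x] and [y], and the remaining
    projections take the same values at [x] and at [y]. *)
Lemma bessel (T : eqType) (e : T -> A) (s : seq T) x : uniq s ->
  orthogonal_projections e s -> \sum_(v <- s) `|pi (e v) x| ^+ 2 <= `|x| ^+ 2.
Proof.
elim: s x => [|v s IH] x; first by move=> _ _; rewrite big_nil exprn_ge0.
move=> /= /andP[vs us] he; rewrite big_cons.
have [sv vv] := he v v (mem_head _ _) (mem_head _ _); rewrite eqxx in vv.
pose y := x - pi (e v) x.
have -> : `|x| ^+ 2 = `|pi (e v) x| ^+ 2 + `|y| ^+ 2.
  rewrite /y -!inner_norm linearBl !linearBr /=.
  rewrite !repr_adjoint sv -!reprM vv.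
  by rewrite subrr subr0 addrC subrK.
rewrite lerD2l; have -> : \sum_(w <- s) `|pi (e w) x| ^+ 2 =
    \sum_(w <- s) `|pi (e w) y| ^+ 2.
  apply: eq_big_seq => w ws; congr (`|_| ^+ 2).
  rewrite /y repr_sub_vec -reprM.
  have [_ ->] := he w v (mem_behead (s := v :: s) ws) (mem_head _ _).
  by case: eqP ws vs => [-> ->//|_ _ _]; rewrite repr0 subr0.
apply: IH => // w w' ws ws'; apply: he; exact: (mem_behead (s := v :: s)).
Qed.

(** By Bessel's inequality each [F n] is finite: summing its defining inequality over n + 1 or more
    of its elements would give (n + 1) |x|^2 <= n |x|^2. *)
Lemma countable_nonvanishing (T : choiceType) (e : T -> A) (D : set T) x :
  (forall s, {in s, forall v, D v} -> orthogonal_projections e s) ->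
  countable [set v | D v /\ pi (e v) x <> 0].
Proof.
move=> he; have [->|x0] := eqVneq x 0.
  rewrite (_ : [set v | _] = set0) //; apply/seteqP; split=> // v [_].
  by rewrite repr_vec0.
have xp : 0 < `|x| ^+ 2 by rewrite exprn_gt0 // normr_gt0.
pose F n := [set v | D v /\ `|x| ^+ 2 < n%:R * `|pi (e v) x| ^+ 2].
have -> : [set v | D v /\ pi (e v) x <> 0] = \bigcup_n F n.
  apply/seteqP; split=> v.
    move=> [Dv /eqP ev]; have ep : 0 < `|pi (e v) x| ^+ 2 by rewrite exprn_gt0 // normr_gt0.
    have [r r0 rE] := gt0_complexP (divr_gt0 xp ep).
    exists (Num.bound r) => //; split=> //; rewrite -ltr_pdivrMr // rE.
    rewrite -(rmorph_nat (real_complex R)) ltcR; apply: archi_boundP; exact: ltW.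
  move=> [n _ [Dv hv]]; split=> // ev; move: hv.
  by rewrite ev normr0 expr0n mulr0 le_gtF // exprn_ge0.
apply: bigcup_countable => // n _; apply: finite_set_countable.
apply: contrapT => /(infinite_set_fset n.+1)[B BF nB].
pose s : seq T := finmap.enum_fset B.
have sF v : v \in s -> F n v by move=> vs; apply: BF.
have us : uniq s by exact: finmap.fset_uniq.
have hs : orthogonal_projections e s by apply: he => v /sF[].
have h1 : \sum_(v <- s) `|x| ^+ 2 <= n%:R * \sum_(v <- s) `|pi (e v) x| ^+ 2.
  rewrite mulr_sumr big_seq [leRHS]big_seq; apply: ler_sum => v /sF[_ /ltW].
  exact.
have h2 : n%:R * \sum_(v <- s) `|pi (e v) x| ^+ 2 <= n%:R * `|x| ^+ 2.
  by apply: ler_wpM2l => //; exact: bessel.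
have := le_trans h1 h2; rewrite big_const_seq count_predT iter_addr_0 -[leLHS]mulr_natl.
by rewrite ler_pM2r // ler_nat leqNgt nB.
Qed.

End RepresentationBound.

(** * No irreducible representation is faithful *)

Section NotPrimitive.
Context (R : realType) (X : choiceType).
Hypothesis uncountableX : ~ countable [set: X].
Local Notation C := R[i].
Local Notation word := (seq X).
Local Notation A := (blockalg R X).
Local Notation E v := (bunit R v v).

Variables (H : hilbertSpace R) (pi : A -> H -> H).
Hypothesis repr : star_representation pi.

Definition letter_kernel (x : X) : set H :=
  [set h | forall v : word, x \in v -> pi (E v) h = 0].

Lemma letter_kernel_closed x : closed (letter_kernel x).
Proof.
have -> : letter_kernel x = \bigcap_(v in [set v : word | x \in v]) (pi (E v) @^-1` [set 0]).
  by apply/seteqP; split=> h hh v xv; exact: hh.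
apply: closed_bigI => v _.
apply: (@bounded_kernel_closed _ _ _ _ (2 * `|E v|)) => [g h||h].
- exact: repr_sub_vec.
- exact: mulr_ge0.
- by rewrite mulrAC; exact: repr_bound.
Qed.

Lemma letter_kernel_submod x : submod_closed (mem (letter_kernel x)).
Proof.
apply/submod_setP; split=> [v _|k g h hg hh v xv]; first exact: repr_vec0.
by rewrite repr_linear // hg // hh // scaler0 addr0.
Qed.

(** By [bunit_total] it suffices to take [a] a matrix unit. Then [E v] times [a] is 0 or a unit
    whose column word is a permutation of a word extending [v], hence contains [x]; that unit
    factors through the projection of its column word, which kills [h]. *)
Lemma letter_kernel_invariant x a h :
  letter_kernel x h -> letter_kernel x (pi a h).
Proof.
move=> hh v xv; rewrite -(reprM repr).
move: a; apply: (@bunit_total _ _ [set a | pi (cmul (E v) a) h = 0]).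
- exact: repr_annihilator_closed.
- apply/submod_setP; split=> [|k a b /= ha hb]; first by rewrite /= cmulr0 repr0.
  by rewrite cmulDr -cscaleAr (reprD repr) (reprZ repr) ha hb scaler0 addr0.
move=> p q pq /=.
have [/prefixP[z pE]|vp] := boolP (prefix v p).
  subst p; rewrite bunit_mulr // -(@bunit_mul _ _ (v ++ z) q q) //.
  rewrite (reprM repr) hh ?repr_vec0 // -(perm_mem pq) mem_cat xv //.
have [/prefixP[z vE]|pv] := boolP (prefix p v).
  subst v; have pzqz : perm_eq (p ++ z) (q ++ z) by rewrite perm_cat2r.
  rewrite bunit_mull // -(@bunit_mul _ _ (p ++ z) (q ++ z) (q ++ z)) //.
  by rewrite (reprM repr) hh ?repr_vec0 // -(perm_mem pzqz).
by rewrite bunit_mul0 // repr0.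
Qed.

(** Distinct words of the same length are incomparable as prefixes. *)
Lemma bunit_orthogonal n (s : seq word) : {in s, forall v, size v = n} ->
  orthogonal_projections (fun v => E v) s.
Proof.
move=> hs v w vs ws; split; first exact: bunit_star.
case: eqP => [->|/eqP vw]; first exact: bunit_mul.
have h (p q : word) : size p = size q -> p != q -> ~~ prefix p q.
  move=> pq; apply: contraNN => /prefixP[z qE].
  move/eqP: pq; rewrite qE size_cat -[eqbLHS]addn0 eqn_add2l eq_sym size_eq0.
  by move/eqP->; rewrite cats0.
by rewrite bunit_mul0 //; apply: h; rewrite ?hs // eq_sym.
Qed.

(** Faithfulness rules out that a letter kernel is the whole space, as [E x x] would act as 0; so by
    irreducibility all of them are zero. For a single nonzero [h], every letter then occurs in some
    word [v] with [pi (E v) h] nonzero. These words are countably many in each length, which would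
    make the alphabet countable. *)
Lemma not_irreducible_faithful : irreducible_representation pi -> ~ injective pi.
Proof.
move=> [[a [y ay]] irr] inj; set h := pi a y in ay.
have ker0 x : letter_kernel x = [set 0].
  have [//|kT] := irr _ (@letter_kernel_closed x) (letter_kernel_submod x)
    (fun a g => @letter_kernel_invariant x a g).
  exfalso; apply: (@bunit_neq0 R X [:: x] [:: x]) => //; apply: inj.
  apply/funext => g; rewrite repr0 //.
  by have : letter_kernel x g by [rewrite kT]; apply; rewrite inE.
pose S n := [set v : word | size v = n /\ pi (E v) h <> 0].
apply: uncountableX.
have -> : [set: X] = \bigcup_n \bigcup_(v in S n) [set` v].
  apply/seteqP; split=> // x _; apply: contrapT => hx; apply: ay.
  suff : letter_kernel x h by rewrite ker0.
  move=> v xv; apply: contrapT => hv; apply: hx.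
  by exists (size v) => //; exists v.
apply: bigcup_countable => // n _; apply: bigcup_countable => [|v _].
  apply: (@countable_nonvanishing _ _ _ _ repr _ (fun v => E v) [set v : word | size v = n]).
  by move=> s hs; exact: (@bunit_orthogonal n).
exact: finite_set_countable.
Qed.

End NotPrimitive.

(** Cantor's diagonal argument on the codes [f B] that do not belong to [B]. *)
Lemma uncountable_powerset : ~ countable [set: set nat].
Proof.
move=> /countable_injP[f finj].
pose D := [set n | exists2 B, f B = n & ~ B n].
have hD : ~ D (f D).
  by move=> Df; have [B fB nB] := Df; have BD := finj _ _ (in_setT B) (in_setT D) fB; apply: nB; rewrite BD.
by apply: (hD); exists D.
Qed.

Theorem theorem1p7 (R : realType) :
  exists A : cstarAlgebraType R,
    AF_algebra A /\ ~ separable_space A /\ prime_algebra A /\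
    ~ primitive_algebra A.
Proof.
(* The alphabet is the powerset of the natural numbers, a concrete uncountable type. *)
exists (blockalg R (set nat)); split; first exact: blockalg_AF.
split; first exact: blockalg_nonseparable uncountable_powerset.
split; first exact: blockalg_prime uncountable_powerset.
move=> [H [pi [repr irr inj]]].
exact: (not_irreducible_faithful uncountable_powerset repr irr inj).
Qed.
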